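(* Let $\mathcal{A}$ be a nonempty collection of real $n\times n$ matrices $a=(a_{ij})_{i,j=1}^n$ with $\sup_{a\in\mathcal{A}}|a_{ij}|<\infty$ for all $i,j$, and let $\sigma$ be a uniform random permutation of $[n]=\{1,\dots,n\}$. Define $$Z=\sup_{a\in\mathcal{A}}\sum_{k=1}^n a_{k\sigma(k)}.$$ Let $D=\sqrt{\frac{\sqrt e}{\sqrt e-1}}$, $A=\mathbb{E}\sup_{a\in\mathcal{A}}\sqrt{\sum_{k=1}^n a_{k\sigma(k)}^2}$ and $B_r=\bigl\|\max_{k\le n}\sup_{a\in\mathcal{A}}|a_{k\sigma(k)}|\bigr\|_r$. Then for any $r\ge2$, $$\|(Z-\mathbb{E}Z)_+\|_r\le 4D\sqrt r\,A+10D^2\,r\,B_r.$$ As a consequence, for any $r\ge0$, $$\mathbb{P}\Bigl(Z\ge\mathbb{E}Z+4eD\sqrt r\,A+10eD^2\,r\,B_r\Bigr)\le e^{2-r}.$$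
   Context: $\|Y\|_r=(\mathbb{E}|Y|^r)^{1/r}$; $t_+=\max(t,0)$. For $r=0$ the term $rB_r$ is read as $0$.
   Formalization: The tail bound is stated for r ≤ 2, or for r > 2 when some matrix in 𝒜 is nonzero; for 𝒜 = {0} (or n = 0) and r > 2 the threshold is 0, the event has probability 1 > e^{2-r}, and the printed bound fails. *)

(* Defs.v *)
From HB Require Import structures.
From mathcomp Require Import all_boot all_order all_algebra perm.
From mathcomp Require Import all_classical all_reals all_analysis.

Set Implicit Arguments.
Unset Strict Implicit.
Unset Printing Implicit Defensive.

Import Order.TTheory GRing.Theory Num.Theory.

Local Open Scope classical_set_scope.
Local Open Scope ring_scope.

Section PermutationStatistics.
Context {R : realType} {n : nat}.
Implicit Types (calA : set 'M[R]_n) (s : 'S_n).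

(* Each [sup] below is taken in [R]; it has its usual meaning because [calA] is
   assumed nonempty and entrywise bounded wherever these notions are used. *)

Definition entrywise_bounded calA : Prop :=
  forall i j : 'I_n, has_ubound [set `|a i j| | a in calA].

Definition sup_sum calA s : R :=
  sup [set \sum_(k < n) a k (s k) | a in calA].

Definition sup_root_sum_sq calA s : R :=
  sup [set Num.sqrt (\sum_(k < n) a k (s k) ^+ 2) | a in calA].

(* The suprema are nonnegative, so the base value 0 is attained as the result
   only when every term vanishes (or when n = 0). *)
Definition max_sup_abs calA s : R :=
  \big[Num.max/0]_(k < n) sup [set `|a k (s k)| | a in calA].

End PermutationStatistics.

Definition uniform_permutation {d : measure_display} {T : measurableType d}
    {R : realType} (P : probability T R) {n : nat} (sigma : T -> 'S_n) : Prop :=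
  forall s : 'S_n, measurable (sigma @^-1` [set s]) /\
    P (sigma @^-1` [set s]) = ((n`!)%:R^-1)%:E.

Definition Dconst (R : realType) : R :=
  let sqrt_e := Num.sqrt (expR 1) in Num.sqrt (sqrt_e / (sqrt_e - 1)).

(* Main.v *)
(** The argument is the entropy method for moments, with random transpositions
    in place of the resampling of independent coordinates.  For [p = 1 + s] in
    (1, 2] and [h > 0] on the symmetric group,

      E h^p - (E h)^p <= 1/(2n) sum_{i,j} E (h - h o tau_ij) (h^s - (h o tau_ij)^s).

    This is proved by induction on the size of the set of positions that are
    permuted: disintegrate over the image of one position [i], use the elementary
    two-point inequality for the conditional means, pull the joint convexity of
    [(x - y)(x^s - y^s)] through the conditional means, and average over [i].
    For [h = f^(q-1)], [s = 1/(q-1)] it bounds [E f^q] by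
    [(E f^(q-1))^(q/(q-1))] plus [(q - 1) E (V f^(q-2))], where
    [V = 1/n sum_{i,j} (f - f o tau_ij)_+^2], and an induction on [q] in unit steps
    gives [||(f - E f)_+||_r <= D sqrt r ||sqrt V||_r].

    Write [W] for the supremum of the root sums of squares and [M] for the maximum
    of the entries.  Then [sqrt V <= 2 M] for [f = W], and
    [sqrt V <= 2 W + 2 sup_a sqrt (1/n sum_{i,j} a_ij^2)] for [f = Z].  As
    [1/n sum a_ij^2] is the second moment of [sqrt (sum_k a_{k sigma(k)}^2)], the
    variance bound for this function controls the last supremum by
    [E W + 2 ||M||_2].  The tail bound is Markov's inequality. *)

Require Import Defs.
From HB Require Import structures.
From mathcomp Require Import all_boot all_order all_algebra perm.
From mathcomp Require Import all_classical all_reals all_analysis.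
From mathcomp Require Import ring lra.

Set Implicit Arguments.
Unset Strict Implicit.
Unset Printing Implicit Defensive.

Import Order.TTheory GRing.Theory Num.Theory.
Import numFieldNormedType.Exports.

Local Open Scope classical_set_scope.
Local Open Scope ring_scope.

(** * Real powers *)

Lemma ler_powR2 (R : realType) (x y p : R) : 0 <= p -> 0 <= x -> x <= y -> x `^ p <= y `^ p.
Proof.
by move=> p0 x0 xy; apply: ge0_ler_powR; rewrite ?nnegrE// (le_trans x0).
Qed.

Lemma powR_root (R : realType) (x p : R) : 0 <= x -> 0 < p -> (x `^ p^-1) `^ p = x.
Proof. by move=> x0 p0; rewrite -powRrM mulVf ?gt_eqF// powRr1. Qed.

Lemma powR_div (R : realType) (x c r : R) : 0 <= x -> 0 < c -> (x / c) `^ r = x `^ r / c `^ r.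
Proof.
move=> x0 c0; rewrite powRM ?invr_ge0 ?(ltW c0)//.
by rewrite -powR_inv1 ?(ltW c0)// -powRrM mulN1r powRN.
Qed.

(** With [L = ln t], the bound [1 + x <= expR x] is used at [(1 - s) * L] and at [- (s * L)];
    combined with weights [s] and [1 - s], the terms in [L] cancel. *)
Lemma powR_le_tangent (R : realType) (s t : R) :
  0 <= s <= 1 -> 0 <= t -> t `^ s <= 1 + s * (t - 1).
Proof.
move=> /andP[s0 s1]; rewrite le_eqVlt => /orP[/eqP <-|t0].
  have [->|s'] := eqVneq s 0; first by rewrite powRr0; lra.
  by rewrite powR0//; lra.
set L := ln t.
have tE : expR L = t by rewrite /L lnK.
have -> : t `^ s = expR (s * L) by rewrite /powR gt_eqF.
have h1 : expR (s * L) * (1 + (1 - s) * L) <= t.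
  rewrite -tE (_ : expR L = expR (s * L) * expR ((1 - s) * L)).
    by rewrite ler_pM2l ?expR_gt0 ?expR_ge1Dx.
  by rewrite -expRD; congr expR; ring.
have h2 : expR (s * L) * (1 - s * L) <= 1.
  have e : expR (s * L) * expR (- (s * L)) = 1 by rewrite -expRD subrr expR0.
  by rewrite -[leRHS]e ler_pM2l ?expR_gt0 ?expR_ge1Dx.
have := lerD (ler_wpM2l s0 h1) (ler_wpM2l (_ : 0 <= 1 - s) h2).
rewrite subr_ge0 => /(_ s1); lra.
Qed.

(** The concave case with exponent [s^-1], applied to [t^s]. *)
Lemma tangent_le_powR (R : realType) (s t : R) :
  1 <= s -> 0 <= t -> 1 + s * (t - 1) <= t `^ s.
Proof.
move=> s1 t0; have s0 : 0 < s by lra.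
have s01 : 0 <= s^-1 <= 1 by rewrite invr_ge0 ltW// invf_le1.
have := powR_le_tangent s01 (powR_ge0 t s).
rewrite -powRrM divff ?gt_eqF// (powRr1 t0) => /(ler_wpM2l (ltW s0)).
by rewrite mulrDr mulr1 mulrA divff ?gt_eqF// mul1r; lra.
Qed.

Lemma powR_le_tangent_at (R : realType) (s x u : R) :
  0 <= s <= 1 -> 0 <= x -> 0 < u -> x `^ s <= u `^ s + s * u `^ (s - 1) * (x - u).
Proof.
move=> s01 x0 u0; have := powR_le_tangent s01 (divr_ge0 x0 (ltW u0)).
rewrite powRM ?invr_ge0 ?x0 ?(ltW u0)// powRB ?(gt_eqF u0) ?implybT//.
rewrite (powRr1 (ltW u0)) -(powR_inv1 (ltW u0)) -powRrM mulN1r (powRN _ s).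
have us : 0 < u `^ s by apply: powR_gt0.
rewrite ler_pdivrMr// => /le_trans; apply; rewrite (powR_inv1 (ltW u0)).
by rewrite le_eqVlt; apply/orP; left; apply/eqP; field; rewrite gt_eqF.
Qed.

Lemma tangent_at_le_powR (R : realType) (s x u : R) :
  1 <= s -> 0 <= x -> 0 < u -> u `^ s + s * u `^ (s - 1) * (x - u) <= x `^ s.
Proof.
move=> s01 x0 u0; have := tangent_le_powR s01 (divr_ge0 x0 (ltW u0)).
rewrite powRM ?invr_ge0 ?x0 ?(ltW u0)// powRB ?(gt_eqF u0) ?implybT//.
rewrite (powRr1 (ltW u0)) -(powR_inv1 (ltW u0)) -powRrM mulN1r (powRN _ s).
have us : 0 < u `^ s by apply: powR_gt0.
rewrite ler_pdivlMr// => /(le_trans _); apply; rewrite (powR_inv1 (ltW u0)).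
by rewrite le_eqVlt; apply/orP; left; apply/eqP; field; rewrite gt_eqF.
Qed.

(** Weighted AM-GM: the tangent of the concave power at [y], multiplied by [y^(1 - th)]. *)
Lemma powR_AGM (R : realType) (th x y : R) :
  0 <= th <= 1 -> 0 <= x -> 0 < y -> x `^ th * y `^ (1 - th) <= th * x + (1 - th) * y.
Proof.
move=> th01 x0 y0; have := powR_le_tangent_at th01 x0 y0.
have ym : 0 < y `^ (1 - th) by apply: powR_gt0.
move=> /(ler_wpM2r (ltW ym)) /le_trans; apply.
have e : y `^ (th - 1) = (y `^ (1 - th))^-1 by rewrite -powRN opprB.
have e2 : y `^ th = y / y `^ (1 - th).
  have e3 : y = y `^ th * y `^ (1 - th).
    by rewrite -powRD ?(gt_eqF y0) ?implybT// addrC subrK powRr1// ltW.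
  by rewrite [in X in X / _]e3 mulfK// gt_eqF.
rewrite e e2 le_eqVlt; apply/orP; left; apply/eqP; field; rewrite gt_eqF//.
Qed.

Lemma tangent0_le (R : realType) (G dG ddG : R -> R) :
  (forall t : R, 0 <= t <= 1 -> is_derive t 1 G (dG t)) ->
  (forall t : R, 0 <= t <= 1 -> is_derive t 1 dG (ddG t)) ->
  (forall t : R, 0 <= t <= 1 -> 0 <= ddG t) ->
  G 0 + dG 0 <= G 1.
Proof.
move=> hG hdG ddG0.
have wc (F dF : R -> R) (c : R) : c <= 1 ->
    (forall t : R, 0 <= t <= 1 -> is_derive t 1 F (dF t)) ->
    {within `[0, c], continuous F}.
  move=> c1 hF; apply: derivable_within_continuous => x.
  rewrite in_itv/= => /andP[x0 xc].
  by have [] := hF x; rewrite ?x0 ?(le_trans xc).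
have oc (F dF : R -> R) (c : R) : c <= 1 ->
    (forall t : R, 0 <= t <= 1 -> is_derive t 1 F (dF t)) ->
    forall x, x \in `]0, c[ -> is_derive x 1 F (dF x).
  move=> c1 hF x; rewrite in_itv/= => /andP[/ltW x0 /ltW xc].
  by apply: hF; rewrite x0 (le_trans xc).
have [c + Gc] := MVT ltr01 (oc _ _ _ (lexx 1) hG) (wc _ _ _ (lexx 1) hG).
rewrite in_itv/= => /andP[c0 c1].
have [e + dGe] := MVT c0 (oc _ _ _ (ltW c1) hdG) (wc _ _ _ (ltW c1) hdG).
rewrite in_itv/= => /andP[e0 ec].
have h : 0 <= dG c - dG 0.
  by rewrite dGe mulr_ge0 ?subr_ge0 ?(ltW c0)// ddG0// (ltW e0) ltW// (lt_trans ec).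
move: Gc; rewrite subr0 mulr1; lra.
Qed.

Lemma is_derive_affine_powR (R : realType) (u a p t : R) : 0 < u + t * a ->
  is_derive t 1 (fun t => (u + t * a) `^ p) (p * (u + t * a) `^ (p - 1) * a).
Proof.
move=> h.
have d1 : is_derive t 1 (fun t : R => u + t * a) a.
  apply: is_derive_eq; rewrite /GRing.scale/=; ring.
have d2 := is_derive1_powR p h.
exact: (@is_derive1_comp R (fun x => x `^ p) (fun t => u + t * a) _ _ _ d2 d1).
Qed.

(* [phi x - phi y - phi' y * (x - y)] for [phi x = x^(1+s)]. *)
Definition bregman {R : realType} (s x y : R) : R :=
  x `^ (1 + s) + s * y `^ (1 + s) - (1 + s) * (x * y `^ s).

(* Divided by [s (1 + s)], the second derivative of [x^(1+s) + s y^(1+s) - (1+s) x y^s]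
   along a segment is [p a^2 - 2 m a b + c b^2] with [p = x^(s-1)], [m = y^(s-1)];
   concavity of [t^(1-s)] gives [m^2 <= p c]. *)
Lemma bregman_tangent (R : realType) (s x y u v : R) : 0 < s <= 1 ->
  0 < x -> 0 < y -> 0 < u -> 0 < v ->
  bregman s u v + (1 + s) * ((u `^ s - v `^ s) * (x - u)
                     + s * (v `^ s - u * v `^ (s - 1)) * (y - v)) <= bregman s x y.
Proof.
move=> /andP[s0 s1] x0 y0 u0 v0.
set a := x - u; set b := y - v.
pose X t := u + t * a; pose Y t := v + t * b.
have X0 (t : R) : 0 <= t <= 1 -> 0 < X t.
  move=> /andP[t0 t1]; rewrite /X /a.
  have [->|t'] := eqVneq t 0; first by rewrite mul0r addr0.
  have : 0 < t * x by rewrite mulr_gt0// lt0r t'.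
  have : 0 <= (1 - t) * u by rewrite mulr_ge0 ?subr_ge0// ltW.
  lra.
have Y0 (t : R) : 0 <= t <= 1 -> 0 < Y t.
  move=> /andP[t0 t1]; rewrite /Y /b.
  have [->|t'] := eqVneq t 0; first by rewrite mul0r addr0.
  have : 0 < t * y by rewrite mulr_gt0// lt0r t'.
  have : 0 <= (1 - t) * v by rewrite mulr_ge0 ?subr_ge0// ltW.
  lra.
pose G t := bregman s (X t) (Y t).
pose dG t := (1 + s) * ((X t `^ s - Y t `^ s) * a + s * (Y t `^ s - X t * Y t `^ (s - 1)) * b).
pose ddG t := (1 + s) * s * (X t `^ (s - 1) * a ^+ 2 - 2 * Y t `^ (s - 1) * a * b
   + (s * Y t `^ (s - 1) + (1 - s) * X t * Y t `^ (s - 2)) * b ^+ 2).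
have powS (z p q : R) : 0 < z -> q = 1 + p -> z `^ q = z * z `^ p.
  by move=> z0 ->; rewrite powRD ?(gt_eqF z0) ?implybT// powRr1// ltW.
have X00 : X 0 = u by rewrite /X mul0r addr0.
have Y00 : Y 0 = v by rewrite /Y mul0r addr0.
have X1 : X 1 = x by rewrite /X /a; ring.
have Y1 : Y 1 = y by rewrite /Y /b; ring.
suff : G 0 + dG 0 <= G 1 by rewrite /G /dG X00 Y00 X1 Y1.
apply: (@tangent0_le R G dG ddG) => t t01.
- have h1 := is_derive_affine_powR (1 + s) (X0 _ t01).
  have h2 := is_derive_affine_powR (1 + s) (Y0 _ t01).
  have h3 := is_derive_affine_powR s (Y0 _ t01).
  rewrite /G /bregman /X /Y; apply: is_derive_eq.
  rewrite /GRing.scale/= /dG /X /Y (_ : 1 + s - 1 = s); last by ring.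
  ring.
- have h1 := is_derive_affine_powR s (X0 _ t01).
  have h2 := is_derive_affine_powR s (Y0 _ t01).
  have h3 := is_derive_affine_powR (s - 1) (Y0 _ t01).
  rewrite /dG /X /Y; apply: is_derive_eq.
  rewrite /GRing.scale/= /ddG /X /Y (_ : s - 1 - 1 = s - 2); last by ring.
  ring.
- have Xt := X0 _ t01; have Yt := Y0 _ t01; rewrite /ddG.
  rewrite mulr_ge0//; first by rewrite mulr_ge0//; lra.
  set p := X t `^ (s - 1); set m := Y t `^ (s - 1).
  have p0 : 0 < p by apply: powR_gt0.
  have m0 : 0 < m by apply: powR_gt0.
  have mE : m = Y t * Y t `^ (s - 2) by apply: powS => //; ring.
  set c := _ + (1 - s) * X t * _.
  have pc : m ^+ 2 <= p * c.
    have s1' : 0 <= 1 - s <= 1 by apply/andP; split; lra.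
    have := powR_AGM s1' (ltW Xt) Yt.
    rewrite (_ : 1 - (1 - s) = s); last by ring.
    have e1 : p * X t `^ (1 - s) = 1.
      by rewrite -powRD ?(gt_eqF Xt) ?implybT// addrC subrKA subrr powRr0.
    have e2 : Y t `^ s = Y t * m by apply: powS => //; ring.
    have cE : c * Y t = m * ((1 - s) * X t + s * Y t).
      by rewrite /c -/m mE; ring.
    rewrite e2 => /(ler_wpM2l (ltW (mulr_gt0 p0 m0))).
    have -> : p * m * (X t `^ (1 - s) * (Y t * m)) = p * X t `^ (1 - s) * (m ^+ 2 * Y t).
      ring.
    by rewrite e1 mul1r -mulrA -cE mulrA ler_pM2r.
  (* Multiplying the quadratic form by [p > 0] allows the square to be completed. *)
  rewrite -(pmulr_rge0 _ p0).
  have -> : p * (p * a ^+ 2 - 2 * m * a * b + c * b ^+ 2) =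
    (p * a - m * b) ^+ 2 + (p * c - m ^+ 2) * b ^+ 2 by ring.
  by rewrite addr_ge0 ?sqr_ge0// mulr_ge0 ?sqr_ge0// subr_ge0.
Qed.

(** * Finite means *)

(** Expectation under the uniform permutation and conditional expectation given one value both take
    this form, over all permutations or over a fibre. *)
Definition mean {R : realType} {I : finType} (P : pred I) (f : I -> R) : R :=
  #|P|%:R^-1 * \sum_(i | P i) f i.

Section Mean.
Context {R : realType} {I : finType} (P : pred I).
Implicit Types f g : I -> R.

Lemma eq_mean f g : (forall i, P i -> f i = g i) -> mean P f = mean P g.
Proof. by move=> fg; rewrite /mean (eq_bigr _ fg). Qed.

Lemma meanD f g : mean P (fun i => f i + g i) = mean P f + mean P g.
Proof. by rewrite /mean big_split mulrDr. Qed.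

Lemma meanZ c f : mean P (fun i => c * f i) = c * mean P f.
Proof. by rewrite /mean -mulr_sumr mulrCA. Qed.

Lemma meanN f : mean P (fun i => - f i) = - mean P f.
Proof. by rewrite /mean sumrN mulrN. Qed.

Lemma meanB f g : mean P (fun i => f i - g i) = mean P f - mean P g.
Proof. by rewrite meanD meanN. Qed.

Lemma mean_sum (J : finType) (Q : pred J) (F : J -> I -> R) :
  mean P (fun i => \sum_(j | Q j) F j i) = \sum_(j | Q j) mean P (F j).
Proof. by rewrite /mean exchange_big mulr_sumr. Qed.

Lemma mean_exchange (J : finType) (Q : pred J) (F : I -> J -> R) :
  mean P (fun i => mean Q (F i)) = mean Q (fun j => mean P (F ^~ j)).
Proof.
by rewrite /mean -!mulr_sumr exchange_big mulrCA.
Qed.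

Lemma mean_ge0 f : (forall i, P i -> 0 <= f i) -> 0 <= mean P f.
Proof. by move=> f0; rewrite mulr_ge0 ?invr_ge0// sumr_ge0. Qed.

Lemma ler_mean f g : (forall i, P i -> f i <= g i) -> mean P f <= mean P g.
Proof. by move=> fg; rewrite ler_wpM2l ?invr_ge0// ler_sum. Qed.

Hypothesis P0 : (0 < #|P|)%N.

Lemma mean_cst (c : R) : mean P (fun=> c) = c.
Proof.
rewrite /mean sumr_const -[c *+ _]mulr_natl mulKf//.
by rewrite pnatr_eq0 -lt0n.
Qed.

Lemma mean_gt0 f : (forall i, P i -> 0 < f i) -> 0 < mean P f.
Proof.
move=> f0; rewrite mulr_gt0 ?invr_gt0 ?ltr0n//.
have [j Pj] : exists j, P j by have /card_gt0P := P0.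
rewrite (bigD1 j)//= ltr_pwDl ?f0// sumr_ge0// => i /andP[/f0 /ltW].
by [].
Qed.

(** Jensen in abstract form: the linear part of a tangent at the means averages to zero. Two
    variables are allowed in order to cover joint convexity. *)
Lemma mean_ge_tangent f X Y (f0 a b : R) :
  (forall i, P i -> f0 + (a * (X i - mean P X) + b * (Y i - mean P Y)) <= f i) ->
  f0 <= mean P f.
Proof.
move=> /ler_mean; rewrite meanD mean_cst meanD !meanZ !meanB !mean_cst !subrr.
by rewrite !mulr0 !addr0.
Qed.

Lemma mean_powR_le (s : R) f : 0 <= s <= 1 -> (forall i, P i -> 0 < f i) ->
  mean P (fun i => f i `^ s) <= mean P f `^ s.
Proof.
move=> s01 f0; rewrite -lerN2 -meanN.
apply: (@mean_ge_tangent _ f f _ (- (s * mean P f `^ (s - 1))) 0) => i Pi.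
have := powR_le_tangent_at s01 (ltW (f0 _ Pi)) (mean_gt0 f0).
lra.
Qed.

Lemma mean_sqrB f : mean P (fun i => (f i - mean P f) ^+ 2) =
  mean P (fun i => f i ^+ 2) - mean P f ^+ 2.
Proof.
transitivity (mean P (fun i => f i ^+ 2 + mean P f ^+ 2 - 2 * mean P f * f i)).
  by apply: eq_mean => i _; ring.
by rewrite meanB meanD mean_cst// meanZ; ring.
Qed.

End Mean.

(** * The symmetrised power gap and its joint convexity *)

Definition powR_gap {R : realType} (s x y : R) : R := (x - y) * (x `^ s - y `^ s).

Section PowRGap.
Context {R : realType} (s : R).
Hypothesis s01 : 0 < s <= 1.

Lemma powR_gapxx (x : R) : powR_gap s x x = 0.
Proof. by rewrite /powR_gap subrr mul0r. Qed.

Lemma powR_gapC (x y : R) : powR_gap s x y = powR_gap s y x.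
Proof. by rewrite /powR_gap; ring. Qed.

Lemma powR_gap_ge0 (x y : R) : 0 <= x -> 0 <= y -> 0 <= powR_gap s x y.
Proof.
move=> x0 y0; have /andP[/ltW s0 _] := s01.
wlog xy : x y x0 y0 / x <= y.
  by move=> h; have [/h->//|/ltW /h] := leP x y; rewrite powR_gapC; apply.
by rewrite mulr_le0 ?subr_le0// ge0_ler_powR.
Qed.

Lemma powR1S (x : R) : 0 < x -> x `^ (1 + s) = x * x `^ s.
Proof. by move=> x0; rewrite powRD ?(gt_eqF x0) ?implybT// powRr1// ltW. Qed.

(* The gap is a symmetrised Bregman divergence, hence jointly convex. *)
Lemma powR_gap_bregman (x y : R) : 0 < x -> 0 < y ->
  (1 + s) * powR_gap s x y = bregman s x y + bregman s y x.
Proof. by move=> x0 y0; rewrite /powR_gap /bregman !powR1S//; ring. Qed.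

(** The tangents of the two Bregman terms at the pair of means add up to one affine minorant. *)
Lemma powR_gap_mean_le (I : finType) (P : pred I) (X Y : I -> R) : (0 < #|P|)%N ->
  (forall i, P i -> 0 < X i) -> (forall i, P i -> 0 < Y i) ->
  powR_gap s (mean P X) (mean P Y) <= mean P (fun i => powR_gap s (X i) (Y i)).
Proof.
move=> P0 X0 Y0; have /andP[s0 _] := s01.
have s1 : 0 < 1 + s by lra.
have u0 := mean_gt0 P0 X0; have v0 := mean_gt0 P0 Y0.
rewrite -(ler_pM2l s1) -meanZ powR_gap_bregman//.
set u := mean P X in u0 *; set v := mean P Y in v0 *.
apply: (@mean_ge_tangent _ _ _ P0 _ X Y _
  ((1 + s) * ((u `^ s - v `^ s) + s * (u `^ s - v * u `^ (s - 1))))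
  ((1 + s) * ((v `^ s - u `^ s) + s * (v `^ s - u * v `^ (s - 1))))) => i Pi.
rewrite powR_gap_bregman ?X0 ?Y0// -/u -/v.
have := bregman_tangent s01 (X0 _ Pi) (Y0 _ Pi) u0 v0.
have := bregman_tangent s01 (Y0 _ Pi) (X0 _ Pi) v0 u0.
lra.
Qed.

(** The double mean expands to twice the covariance of [F] and [F^s], and Jensen for the concave
    power [s] compares this covariance with the entropy. *)
Lemma powR_entropy_le_gap (I : finType) (P : pred I) (F : I -> R) : (0 < #|P|)%N ->
  (forall i, P i -> 0 < F i) ->
  mean P (fun i => F i `^ (1 + s)) - mean P F `^ (1 + s) <=
  2^-1 * mean P (fun i => mean P (fun j => powR_gap s (F i) (F j))).
Proof.
move=> P0 F0; have /andP[s0 s1] := s01.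
have u0 := mean_gt0 P0 F0.
rewrite powR1S//.
have -> : mean P (fun i => mean P (fun j => powR_gap s (F i) (F j))) =
   2 * (mean P (fun i => F i `^ (1 + s)) - mean P F * mean P (fun i => F i `^ s)).
  transitivity (mean P (fun i => F i `^ (1 + s) + mean P (fun i => F i `^ (1 + s))
    - (mean P F * F i `^ s + mean P (fun i => F i `^ s) * F i))).
    apply: eq_mean => i Pi.
    transitivity (mean P (fun j => F i `^ (1 + s) + F j `^ (1 + s) - (F i `^ s * F j + F i * F j `^ s))).
      by apply: eq_mean => j Pj; rewrite /powR_gap !powR1S ?F0//; ring.
    by rewrite meanB !meanD !meanZ !(mean_cst P0); ring.
  by rewrite meanB !meanD !(mean_cst P0) !meanZ; ring.
have : mean P (fun i => F i `^ s) <= mean P F `^ s.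
  by apply: mean_powR_le => //; rewrite ltW.
move=> /(ler_wpM2l (ltW u0)); lra.
Qed.

End PowRGap.

(** * The Beckner inequality for random transpositions *)

Section FibrePerm.
Context {n : nat}.
Implicit Types (A : {set 'I_n}) (i j k : 'I_n) (t r : 'S_n).

Definition perm_fibre A i j : pred 'S_n := fun t => perm_on A t && (t i == j).

(** Since [(t * u) i = u (t i)], right multiplication permutes values and left multiplication
    permutes positions. Exchanging the values [j] and [k] matches the fibre over [j] with the fibre
    over [k]. *)
Lemma perm_fibre_mul A i j k t : j \in A -> k \in A ->
  perm_fibre A i k (t * tperm j k)%g = perm_fibre A i j t.
Proof.
move=> jA kA.
have on (x : 'S_n) : perm_on A x -> perm_on A (x * tperm j k)%g.
  move=> xA; apply: perm_onM => //; apply/fintype.subsetP => l.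
  rewrite inE/=; apply: contraR => lA; rewrite tpermD//.
    by apply: contraNneq lA => <-.
  by apply: contraNneq lA => <-.
have -> : perm_fibre A i j t = perm_on A t && ((t * tperm j k)%g i == k).
  by rewrite /perm_fibre permM -[X in _ = _ && (_ == X)](tpermL j k) (inj_eq perm_inj).
rewrite /perm_fibre; congr (_ && _); apply/idP/idP => /on //.
by rewrite -mulgA tperm2 mulg1.
Qed.

Lemma perm_on_setD1 A i t : i \in A -> perm_on (A :\ i)%SET t = perm_fibre A i i t.
Proof.
move=> iA; apply/idP/andP => [/fintype.subsetP tAi|[/fintype.subsetP tA /eqP ti]].
  split; first by apply/fintype.subsetP => l /tAi; rewrite in_setD1 => /andP[].
  by apply: contraT => /tAi; rewrite in_setD1 eqxx.
apply/fintype.subsetP => l lt; rewrite in_setD1 (tA _ lt) andbT.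
by apply: contraTneq lt => ->; rewrite inE ti eqxx.
Qed.

Lemma sum_perm_fibre (R : realType) A i j k (f : 'S_n -> R) : j \in A -> k \in A ->
  \sum_(t | perm_fibre A i k t) f t =
  \sum_(t | perm_fibre A i j t) f (t * tperm j k)%g.
Proof.
move=> jA kA; rewrite (reindex_inj (mulIg (tperm j k)))/=.
by apply: eq_bigl => t; rewrite perm_fibre_mul.
Qed.

Lemma card_perm_fibre A i j : i \in A -> j \in A ->
  #|perm_fibre A i j| = (#|A|.-1)`!.
Proof.
move=> iA jA; transitivity #|perm_on (A :\ i)%SET|; last first.
  by rewrite card_perm (cardsD1 i A) iA.
rewrite -!sum1_card (reindex_inj (mulIg (tperm i j)))/=.
apply: eq_bigl => t; transitivity (perm_fibre A i j (t * tperm i j)%g) => //.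
by rewrite perm_fibre_mul// -perm_on_setD1.
Qed.

(** Fibres are coupled by exchanging values, whereas the energy exchanges positions; this identity
    turns one into the other. *)
Lemma mul_tperm_perm_fibre A i j k t : perm_fibre A i j t ->
  (t * tperm j k = tperm i (t^-1 k) * t)%g.
Proof.
move=> /andP[_ /eqP <-].
by rewrite -{1}(permKV t k) -tpermJ conjgE mulgA mulgV mul1g.
Qed.

Context {R : realType}.
Implicit Types f : 'S_n -> R.

Lemma mean_perm_fibre A i j k f : i \in A -> j \in A -> k \in A ->
  mean (perm_fibre A i k) f =
  mean (perm_fibre A i j) (fun t => f (t * tperm j k)%g).
Proof.
by move=> iA jA kA; rewrite /mean !card_perm_fibre// (sum_perm_fibre _ _ jA).
Qed.

(** Translation to the fibre that fixes [i] makes a conditional mean a mean over permutations of one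
    position fewer, ready for the induction. *)
Lemma mean_perm_fibre_setD1 A i j f : i \in A -> j \in A ->
  mean (perm_fibre A i j) f =
  mean (perm_on (A :\ i)%SET) (fun t => f (t * tperm i j)%g).
Proof.
move=> iA jA; rewrite (mean_perm_fibre _ iA iA)// /mean.
rewrite (_ : #|_| = #|perm_on (A :\ i)%SET|); last first.
  apply: eq_card => t; transitivity (perm_fibre A i i t) => //.
  by rewrite -perm_on_setD1.
by congr (_ * _); apply: eq_bigl => t; rewrite perm_on_setD1.
Qed.

(** All fibres have the same cardinality, so the image of [i] is uniform on [A]. *)
Lemma mean_perm_on_fibres A i f : i \in A ->
  mean (perm_on A) f = mean (mem A) (fun j => mean (perm_fibre A i j) f).
Proof.
move=> iA; rewrite /mean card_perm.
rewrite (partition_big (fun t : 'S_n => t i) (mem A))/=; last first.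
  by move=> t tA; rewrite perm_closed.
rewrite !mulr_sumr; apply: eq_bigr => j jA.
rewrite card_perm_fibre// mulrA; congr (_ * _).
by rewrite (cardsD1 i A) iA/= factS natrM invfM.
Qed.

Lemma sum_perm_on A t (g : 'I_n -> R) : perm_on A t ->
  \sum_(k in A) g ((t^-1)%g k) = \sum_(k in A) g k.
Proof.
move=> tA; rewrite [RHS](reindex_inj (@perm_inj _ (t^-1)%g))/=.
by apply: eq_bigl => k; rewrite perm_closed// perm_onV.
Qed.

End FibrePerm.

Section BecknerPerm.
Context {R : realType} {n : nat} (s : R).
Hypothesis s01 : 0 < s <= 1.
Implicit Types (A : {set 'I_n}) (i j k : 'I_n) (t : 'S_n) (h : 'S_n -> R).

Let flow A h (a b : 'I_n) : R :=
  mean (perm_on A) (fun t => powR_gap s (h t) (h (tperm a b * t)%g)).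

Let flow_ge0 A h a b : (forall t, 0 < h t) -> 0 <= flow A h a b.
Proof. by move=> h0; apply: mean_ge0 => t _; rewrite powR_gap_ge0// ltW. Qed.

Let flowaa A h a : flow A h a a = 0.
Proof.
rewrite /flow /mean big1 ?mulr0// => t _.
by rewrite tperm1 mul1g powR_gapxx.
Qed.

Let card_perm_on_gt0 A : (0 < #|perm_on A|)%N.
Proof. by rewrite card_perm fact_gt0. Qed.

(** The entropy splits over the image of [i]. The part inside the fibres is the induction
    hypothesis; the part carried by the fibre means [F] is bounded by [powR_entropy_le_gap] and
    costs only swaps that involve [i]. *)
Let perm_entropy_step A h i : i \in A -> (forall t, 0 < h t) ->
  (forall g, (forall t, 0 < g t) ->
    mean (perm_on (A :\ i)%SET) (fun t => g t `^ (1 + s))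
    - mean (perm_on (A :\ i)%SET) g `^ (1 + s) <=
    (2 * #|(A :\ i)%SET|%:R)^-1 *
      \sum_(a in (A :\ i)%SET) \sum_(b in (A :\ i)%SET) flow (A :\ i)%SET g a b) ->
  mean (perm_on A) (fun t => h t `^ (1 + s)) - mean (perm_on A) h `^ (1 + s) <=
  (2 * #|(A :\ i)%SET|%:R)^-1 *
      (\sum_(a in (A :\ i)%SET) \sum_(b in (A :\ i)%SET) flow A h a b)
  + (2 * #|A|%:R)^-1 * \sum_(b in A) flow A h i b.
Proof.
move=> iA h0 IH.
have A0 : (0 < #|mem A|)%N by apply/card_gt0P; exists i.
have fib0 j : j \in A -> (0 < #|perm_fibre A i j|)%N.
  by move=> jA; rewrite card_perm_fibre// fact_gt0.
set F := fun j => mean (perm_fibre A i j) h.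
have F0 j : j \in A -> 0 < F j by move=> jA; apply: mean_gt0 => //; exact: fib0.
rewrite (mean_perm_on_fibres _ iA) (mean_perm_on_fibres h iA) -/F.
have -> : mean (mem A) (fun j => mean (perm_fibre A i j) (fun t => h t `^ (1 + s)))
    - mean (mem A) F `^ (1 + s) =
    mean (mem A) (fun j => mean (perm_fibre A i j) (fun t => h t `^ (1 + s)) - F j `^ (1 + s))
    + (mean (mem A) (fun j => F j `^ (1 + s)) - mean (mem A) F `^ (1 + s)).
  by rewrite meanB; ring.
apply: lerD.
  have -> : \sum_(a in (A :\ i)%SET) \sum_(b in (A :\ i)%SET) flow A h a b =
    mean (mem A) (fun j => \sum_(a in (A :\ i)%SET) \sum_(b in (A :\ i)%SET)
      mean (perm_fibre A i j) (fun t => powR_gap s (h t) (h (tperm a b * t)%g))).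
    rewrite mean_sum; apply: eq_bigr => a _; rewrite mean_sum; apply: eq_bigr => b _.
    by rewrite /flow (mean_perm_on_fibres _ iA).
  rewrite -meanZ; apply: ler_mean => j jA.
  rewrite /F !(mean_perm_fibre_setD1 _ iA jA).
  (* Right translation by [tperm i j] commutes with the position swaps, which act on the left. *)
  apply: (le_trans (IH (fun t => h (t * tperm i j)%g) _)) => //.
  rewrite le_eqVlt; apply/orP; left; apply/eqP; congr (_ * _).
  apply: eq_bigr => a _; apply: eq_bigr => b _; rewrite mean_perm_fibre_setD1//.
  by apply: eq_mean => t _; rewrite mulgA.
apply: (le_trans (powR_entropy_le_gap s01 A0 F0)).
rewrite invfM -mulrA ler_pM2l ?invr_gt0//.
have -> : #|A|%:R^-1 * (\sum_(b in A) flow A h i b) =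
   mean (mem A) (fun j => mean (perm_fibre A i j) (fun t =>
     mean (mem A) (fun l => powR_gap s (h t) (h (tperm i l * t)%g)))).
  by rewrite -mean_perm_on_fibres// mean_exchange.
apply: ler_mean => j jA.
(* The coupling by [tperm j k] writes both fibre means over the fibre of [j], so that joint
   convexity applies. *)
apply: (@le_trans _ _ (mean (mem A) (fun k => mean (perm_fibre A i j)
  (fun t => powR_gap s (h t) (h (t * tperm j k)%g))))).
  apply: ler_mean => k kA; rewrite {2}/F (mean_perm_fibre h iA jA kA).
  by apply: powR_gap_mean_le => //; exact: fib0.
(* For fixed [t], the partner position [t^-1 k] runs over [A] as the value [k] does. *)
rewrite mean_exchange; apply: ler_mean => t tij.
rewrite /mean ler_wpM2l ?invr_ge0// (eq_bigr _ (fun k _ => congr1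
  (fun u => powR_gap s (h t) (h u)) (mul_tperm_perm_fibre k tij))).
by rewrite (sum_perm_on (fun l => powR_gap s (h t) (h (tperm i l * t)%g)))//; case/andP: tij.
Qed.

Theorem beckner_perm_on A h : (forall t, 0 < h t) ->
  mean (perm_on A) (fun t => h t `^ (1 + s)) - mean (perm_on A) h `^ (1 + s) <=
  (2 * #|A|%:R)^-1 * \sum_(a in A) \sum_(b in A)
    mean (perm_on A) (fun t => powR_gap s (h t) (h (tperm a b * t)%g)).
Proof.
have [m] := ubnP #|A|; elim: m => // m IHm in A h *; rewrite ltnS => Am h0.
rewrite -/(flow A h _ _).
have [A1|A1] := leqP #|A| 1.
  have on1 t : perm_on A t -> t = 1%g by move=> tA; exact: perm_on_id tA A1.
  rewrite (@eq_mean _ _ _ _ (fun=> h 1%g `^ (1 + s))) => [|t /on1 ->//].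
  rewrite (@eq_mean _ _ _ h (fun=> h 1%g)) => [|t /on1 ->//].
  rewrite !mean_cst// subrr mulr_ge0 ?invr_ge0 ?mulr_ge0//.
  by do 2!apply: sumr_ge0 => ? _; exact: flow_ge0.
set S := \sum_(a in A) _.
set m1 := #|A|%:R in A1 *.
have step i : i \in A -> 
  mean (perm_on A) (fun t => h t `^ (1 + s)) - mean (perm_on A) h `^ (1 + s) <=
  (2 * (m1 - 1))^-1 *
      (\sum_(a in (A :\ i)%SET) \sum_(b in (A :\ i)%SET) flow A h a b)
  + (2 * m1)^-1 * \sum_(b in A) flow A h i b.
  move=> iA.
  have Ai : #|A| = #|(A :\ i)%SET|.+1 by rewrite (cardsD1 i A) iA.
  have -> : m1 - 1 = #|(A :\ i)%SET|%:R by rewrite /m1 Ai -natr1 addrK.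
  apply: perm_entropy_step => // g g0; apply: IHm => //.
  by rewrite -Ai.
(* Summed over [i], each pair [a != b] is counted [#|A| - 2] times. *)
have inner i : i \in A ->
    \sum_(a in (A :\ i)%SET) \sum_(b in (A :\ i)%SET) flow A h a b =
    S - \sum_(b in A) flow A h i b - \sum_(a in A) flow A h a i.
  move=> iA; rewrite /S (big_setD1 i iA)/= [X in _ = _ - X](big_setD1 i iA)/= flowaa add0r.
  rewrite [X in _ = X - _]addrAC subrr add0r -sumrB; apply: eq_bigr => a _.
  by rewrite [in RHS](big_setD1 i iA)/= addrAC subrr add0r.
have := @ler_sum _ _ (index_enum _) _ _ _ step.
rewrite sumr_const -[_ *+ #|A|]mulr_natl -/m1 big_split/= -!mulr_sumr -/S.
rewrite (eq_bigr _ inner) !sumrB sumr_const -[S *+ _]mulr_natl -/m1.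
rewrite [\sum_(i in A) \sum_(a in A) flow A h a i]exchange_big/= -/S.
have S0 : 0 <= S by do 2!apply: sumr_ge0 => ? _; exact: flow_ge0.
have m2 : 2 <= m1 by rewrite /m1 ler_nat.
set Ent := mean _ _ - _ => le_mEnt.
have m0 : 0 < m1 by lra.
rewrite -(ler_pM2l m0); apply: (le_trans le_mEnt).
(* With [m = m1], the coefficient of [S] is [1/2 - 1/(2 m (m - 1))], so the constant [1/(2 m)]
   survives the averaging. *)
have -> : (2 * (m1 - 1))^-1 * (m1 * S - S - S) + (2 * m1)^-1 * S =
  m1 * ((2 * m1)^-1 * S) - (2 * m1 * (m1 - 1))^-1 * S.
  field; apply/andP; split; apply/eqP; lra.
by rewrite gerBl mulr_ge0// invr_ge0 !mulr_ge0//; lra.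
Qed.

End BecknerPerm.

(** * Norm inequalities for finite means *)

Section MeanNorms.
Context {R : realType} {I : finType} (P : pred I).
Hypothesis P0 : (0 < #|P|)%N.
Implicit Types (X Y : I -> R) (a b c q r : R).

(** A norm bound by [c] is expressed through [r]-th powers; normalising [c] to 1 lets a pointwise
    inequality be averaged directly in the lemmas below. *)
Lemma mean_powR_div_le1 X c r : 0 < c -> (forall i, P i -> 0 <= X i) ->
  (mean P (fun i => (X i / c) `^ r) <= 1) = (mean P (fun i => X i `^ r) <= c `^ r).
Proof.
move=> c0 X0; have cr : 0 < c `^ r by apply: powR_gt0.
rewrite (eq_mean (g := fun i => (c `^ r)^-1 * X i `^ r)); last first.
  by move=> i Pi; rewrite powR_div ?X0// mulrC.
by rewrite meanZ ler_pdivrMl// mulr1.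
Qed.

(** After normalisation, the tangent at 1 of the concave power [q / r] is averaged. *)
Lemma mean_powR_le_mono X c q r : 0 < q <= r -> 0 < c ->
  (forall i, P i -> 0 <= X i) ->
  mean P (fun i => X i `^ r) <= c `^ r -> mean P (fun i => X i `^ q) <= c `^ q.
Proof.
move=> /andP[q0 qr] c0 X0; rewrite -!mean_powR_div_le1// => Xr.
have r0 : 0 < r by lra.
have qr01 : 0 <= q / r <= 1.
  by rewrite ler_pdivrMr// mul1r qr andbT divr_ge0// ltW.
apply: (@le_trans _ _ (mean P (fun i => 1 + q / r * ((X i / c) `^ r - 1)))).
  apply: ler_mean => i Pi; have -> : (X i / c) `^ q = (X i / c) `^ (q / r * r) by rewrite divfK// gt_eqF.
  rewrite [q / r * r]mulrC powRrM.
  exact: (powR_le_tangent qr01 (powR_ge0 _ _)).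
rewrite meanD meanZ meanB !mean_cst//.
have /andP[qr0 _] := qr01.
rewrite gerDl mulr_ge0_le0// subr_le0//.
Qed.

(** Hölder with conjugate weights [2 / q] and [1 - 2 / q]: pointwise AM-GM after normalisation. *)
Lemma mean_powR_hoelder X Y a b q : 2 <= q -> 0 < a -> 0 < b ->
  (forall i, P i -> 0 <= X i) -> (forall i, P i -> 0 < Y i) ->
  mean P (fun i => X i `^ q) <= a `^ q -> mean P (fun i => Y i `^ q) <= b `^ q ->
  mean P (fun i => X i ^+ 2 * Y i `^ (q - 2)) <= a ^+ 2 * b `^ (q - 2).
Proof.
move=> q2 a0 b0 X0 Y0; have q0 : 0 < q by lra.
have Y0' i : P i -> 0 <= Y i by move=> /Y0 /ltW.
rewrite -(mean_powR_div_le1 q a0 X0) -(mean_powR_div_le1 q b0 Y0') => Xq Yq.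
have ab : 0 < a ^+ 2 * b `^ (q - 2) by rewrite mulr_gt0 ?exprn_gt0 ?powR_gt0.
have th01 : 0 <= 2 / q <= 1 by rewrite ler_pdivrMr// mul1r q2 andbT divr_ge0// ltW.
rewrite -[leRHS]mulr1 -ler_pdivrMl// -meanZ.
apply: (@le_trans _ _ (mean P (fun i => 2 / q * (X i / a) `^ q + (1 - 2 / q) * (Y i / b) `^ q))).
  apply: ler_mean => i Pi.
  have Yb : 0 < (Y i / b) `^ q by apply/powR_gt0/divr_gt0 => //; exact: Y0.
  have := powR_AGM th01 (powR_ge0 (X i / a) q) Yb.
  rewrite -!powRrM (_ : q * (2 / q) = 2); last by field; rewrite gt_eqF.
  rewrite (_ : q * (1 - 2 / q) = q - 2); last by field; rewrite gt_eqF.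
  have Xa : 0 <= X i / a by rewrite divr_ge0 ?X0// ltW.
  rewrite (powR_mulrn 2 Xa) powR_div ?Y0'// => /(le_trans _); apply.
  by rewrite le_eqVlt; apply/orP; left; apply/eqP; field; rewrite !gt_eqF ?powR_gt0.
rewrite meanD !meanZ; have /andP[t0 t1] := th01.
have := ler_wpM2l t0 Xq; have := ler_wpM2l (_ : 0 <= 1 - 2 / q) Yq.
rewrite subr_ge0 => /(_ t1); lra.
Qed.

(** The normalised sum is a convex combination, with weights [a / (a + b)] and [b / (a + b)], of the
    normalised terms. *)
Lemma mean_powR_minkowski X Y a b r : 1 <= r -> 0 < a -> 0 < b ->
  (forall i, P i -> 0 <= X i) -> (forall i, P i -> 0 <= Y i) ->
  mean P (fun i => X i `^ r) <= a `^ r -> mean P (fun i => Y i `^ r) <= b `^ r ->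
  mean P (fun i => (X i + Y i) `^ r) <= (a + b) `^ r.
Proof.
move=> r1 a0 b0 X0 Y0; have ab : 0 < a + b by rewrite addr_gt0.
rewrite -(mean_powR_div_le1 r a0 X0) -(mean_powR_div_le1 r b0 Y0) => Xr Yr.
rewrite -mean_powR_div_le1//; last by move=> i Pi; rewrite addr_ge0 ?X0 ?Y0.
set la := a / (a + b).
have laE : 1 - la = b / (a + b) by rewrite /la; field; rewrite gt_eqF.
have la0 : 0 <= la by rewrite divr_ge0 ?(ltW a0)// ltW.
have la1 : 0 <= 1 - la by rewrite laE divr_ge0 ?(ltW b0)// ltW.
apply: (@le_trans _ _ (mean P (fun i => la * (X i / a) `^ r + (1 - la) * (Y i / b) `^ r))).
  apply: ler_mean => i Pi.
  set x := X i / a; set y := Y i / b.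
  have x0 : 0 <= x by rewrite divr_ge0 ?X0// ltW.
  have y0 : 0 <= y by rewrite divr_ge0 ?Y0// ltW.
  have -> : (X i + Y i) / (a + b) = la * x + (1 - la) * y.
    by rewrite laE /la /x /y; field; rewrite !gt_eqF.
  have := addr_ge0 (mulr_ge0 la0 x0) (mulr_ge0 la1 y0).
  (* The tangent needs a positive base point; at base point 0 the left side vanishes. *)
  rewrite le_eqVlt => /orP[/eqP <-|u0].
    have r0 : r != 0 by apply: lt0r_neq0; lra.
    by rewrite (powR0 r0) addr_ge0// mulr_ge0// powR_ge0.
  have := lerD (ler_wpM2l la0 (tangent_at_le_powR r1 x0 u0))
     (ler_wpM2l la1 (tangent_at_le_powR r1 y0 u0)).
  lra.
rewrite meanD !meanZ.
by have := ler_wpM2l la0 Xr; have := ler_wpM2l la1 Yr; lra.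
Qed.

Lemma mean_powR_scale X (k a r : R) : 0 <= k -> 0 <= a -> (forall i, P i -> 0 <= X i) ->
  mean P (fun i => X i `^ r) <= a `^ r ->
  mean P (fun i => (k * X i) `^ r) <= (k * a) `^ r.
Proof.
move=> k0 a0 X0 Xa; rewrite powRM//.
rewrite (eq_mean (g := fun i => k `^ r * X i `^ r)) => [|i Pi]; last by rewrite powRM ?X0.
by rewrite meanZ ler_wpM2l ?powR_ge0.
Qed.

Lemma mean_powR_addc X (a e r : R) : 1 <= r -> 0 < a -> 0 < e ->
  (forall i, P i -> 0 <= X i) ->
  mean P (fun i => X i `^ r) <= a `^ r ->
  mean P (fun i => (X i + e) `^ r) <= (a + e) `^ r.
Proof.
move=> r1 a0 e0 X0 Xa; apply: (mean_powR_minkowski (Y := fun=> e) r1 a0 e0) => //.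
- by move=> i _; exact: ltW.
- by rewrite mean_cst.
Qed.

End MeanNorms.

(** * Moment bounds for functions of a random permutation *)

(** The quantity [V] of the entropy method. Only drops of [f] count: for a supremum, a
    near-maximiser at [t] remains a candidate after the swap and so bounds the drop. *)
Definition up_var {R : realType} {n : nat} (f : 'S_n -> R) (t : 'S_n) : R :=
  n%:R^-1 * \sum_i \sum_j Num.max (f t - f (tperm i j * t)%g) 0 ^+ 2.

Section PermMoments.
Context {R : realType} {n : nat}.
Implicit Types (f g h U : 'S_n -> R) (q r c : R).

Local Notation E f := (mean (@predT 'S_n) f).

Lemma card_predT_perm_gt0 : (0 < #|@predT 'S_n|)%N.
Proof. by apply/card_gt0P; exists 1%g. Qed.
Let S0 := card_predT_perm_gt0.

Lemma mean_perm_onT f : mean (perm_on [set: 'I_n]%SET) f = E f.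
Proof.
have onT t : perm_on [set: 'I_n]%SET t.
  by apply/fintype.subsetP => i _; rewrite finset.in_setT.
rewrite /mean; congr (_^-1 * _); last by apply: eq_bigl => t; rewrite onT.
by congr (_%:R); apply: eq_card => t; exact: onT.
Qed.

Lemma mean_mulg f (u : 'S_n) : E (fun t => f (u * t)%g) = E f.
Proof. by rewrite /mean [in RHS](reindex_inj (mulgI u)). Qed.

Lemma moment_step f q : 2 <= q -> (forall t, 0 < f t) ->
  E (fun t => f t `^ q) <= E (fun t => f t `^ (q - 1)) `^ (q / (q - 1))
    + (q - 1) * E (fun t => up_var f t * f t `^ (q - 2)).
Proof.
move=> q2 f0; set s := (q - 1)^-1.
have q1 : 0 < q - 1 by lra.
have s01 : 0 < s <= 1 by rewrite invr_gt0 q1 invf_le1//; lra.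
have sE : 1 + s = q / (q - 1) by rewrite /s; field; rewrite gt_eqF.
have := @beckner_perm_on R n s s01 [set: 'I_n]%SET (fun t => f t `^ (q - 1))
  (fun t => powR_gt0 _ (f0 t)).
rewrite !mean_perm_onT sE.
rewrite (@eq_mean _ _ _ _ (fun t => f t `^ q)); last first.
  by move=> t _; rewrite -powRrM mulrC divfK// gt_eqF.
rewrite lerBlDl => /le_trans; apply; rewrite lerD2l.
rewrite /up_var -meanZ.
(* [G] is the one-sided half of the gap, nonzero only for [x > y]; the tangent of the power [q - 1]
   is then taken at [x]. *)
pose G (x y : R) := Num.max (x - y) 0 * (x `^ (q - 1) - y `^ (q - 1)).
have gapE x y : 0 < x -> 0 < y -> powR_gap s (x `^ (q - 1)) (y `^ (q - 1)) = G x y + G y x.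
  move=> x0 y0; rewrite /powR_gap /G -!powRrM /s divff ?gt_eqF// !powRr1 ?ltW//.
  have e : x - y = Num.max (x - y) 0 - Num.max (y - x) 0.
    by case: leP => h1; case: leP => h2; lra.
  by rewrite [X in _ * X = _]e; ring.
have Gle x y : 0 < x -> 0 < y ->
    G x y <= (q - 1) * (x `^ (q - 2) * Num.max (x - y) 0 ^+ 2).
  move=> x0 y0; rewrite /G; have [xy|yx] := leP (x - y) 0.
    by rewrite !mul0r expr0n/= !mulr0.
  have q11 : 1 <= q - 1 by lra.
  have := tangent_at_le_powR q11 (ltW y0) x0.
  rewrite (_ : q - 1 - 1 = q - 2); last by ring.
  move=> h; have : x `^ (q - 1) - y `^ (q - 1) <= (q - 1) * x `^ (q - 2) * (x - y) by lra.
  by move=> /(ler_wpM2l (ltW yx)) /le_trans; apply; rewrite le_eqVlt; apply/orP; left; apply/eqP; ring.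
(* Invariance of the mean under [tperm a b] gives both halves the same mean; the factor 2 cancels
   the one half in [beckner_perm_on]. *)
have pair_le a b : E (fun t => powR_gap s (f t `^ (q - 1)) (f (tperm a b * t)%g `^ (q - 1))) <=
    2 * E (fun t => (q - 1) * (f t `^ (q - 2) * Num.max (f t - f (tperm a b * t)%g) 0 ^+ 2)).
  rewrite (eq_mean (g := fun t => G (f t) (f (tperm a b * t)%g) + G (f (tperm a b * t)%g) (f t))); last first.
    by move=> t _; rewrite gapE.
  rewrite meanD -[X in _ + X](mean_mulg _ (tperm a b)).
  rewrite (eq_mean (g := fun t => G (f t) (f (tperm a b * t)%g))) => [|t _]; last first.
    by rewrite mulgA tperm2 mul1g.
  by rewrite mulr_natl mulr2n; apply: lerD; apply: ler_mean => t _; exact: Gle.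
rewrite cardsT card_ord.
apply: (@le_trans _ _ ((2 * n%:R)^-1 * \sum_(a in [set: 'I_n]%SET) \sum_(b in [set: 'I_n]%SET)
  (2 * E (fun t => (q - 1) * (f t `^ (q - 2) * Num.max (f t - f (tperm a b * t)%g) 0 ^+ 2))))).
  rewrite ler_wpM2l ?invr_ge0 ?mulr_ge0//.
  apply: ler_sum => a _; apply: ler_sum => b _.
  rewrite mean_perm_onT; exact: pair_le.
rewrite (eq_bigr (fun a => 2 * E (fun t => \sum_(b in [set: 'I_n]%SET)
  (q - 1) * (f t `^ (q - 2) * Num.max (f t - f (tperm a b * t)%g) 0 ^+ 2)))); last first.
  by move=> a _; rewrite -mulr_sumr -mean_sum.
rewrite -mulr_sumr -mean_sum mulrA -meanZ.
have inT : (fun i : 'I_n => i \in [set: 'I_n]%SET) =1 predT.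
  by move=> i; rewrite finset.in_setT.
apply: ler_mean => t _; rewrite (eq_bigl _ _ inT).
rewrite (eq_bigr (fun a => (q - 1) * f t `^ (q - 2) *
    \sum_b Num.max (f t - f (tperm a b * t)%g) 0 ^+ 2)); last first.
  move=> a _; rewrite (eq_bigl _ _ inT) mulr_sumr.
  by apply: eq_bigr => b _; rewrite mulrA.
rewrite -mulr_sumr le_eqVlt; apply/orP; left; apply/eqP.
by rewrite invfM; move: (n%:R^-1) => k; field.
Qed.

(** The case [q = 2] of [moment_step]. Adding the constant [K] makes the function positive and
    changes neither the variance nor [up_var]. *)
Lemma perm_variance_le f : E (fun t => (f t - E f) ^+ 2) <= E (up_var f).
Proof.
pose K := 1 + \sum_t `|f t|.
pose g t := f t + K.
have g0 t : 0 < g t.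
  rewrite /g /K (bigD1 t)//=.
  have : 0 <= \sum_(i | i != t) `|f i| by rewrite sumr_ge0.
  have := ler_norm (- f t); rewrite normrN; lra.
have := moment_step (lexx 2) g0.
rewrite (_ : 2 - 1 = 1 :> R); last by ring.
rewrite divr1 mul1r.
rewrite (eq_mean (g := fun t => g t ^+ 2)) => [|t _]; last by rewrite powR_mulrn// ltW.
rewrite (@eq_mean _ _ _ (fun t => g t `^ 1) g) => [|t _]; last by rewrite powRr1// ltW.
rewrite (@eq_mean _ _ _ (fun t => up_var g t * g t `^ (2 - 2)) (up_var f)) => [|t _]; last first.
  rewrite subrr powRr0 mulr1 /up_var; congr (_ * _).
  apply: eq_bigr => i _; apply: eq_bigr => j _.
  by congr (Num.max _ _ ^+ 2); rewrite /g; ring.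
rewrite powR_mulrn; last by apply: mean_ge0 => t _; exact: ltW.
move=> h; rewrite -(lerD2l (E g ^+ 2)); apply: le_trans h.
have gE : E g = E f + K by rewrite /g meanD mean_cst.
rewrite gE -[X in X + _](mean_cst S0) -meanD.
rewrite le_eqVlt; apply/orP; left; apply/eqP.
transitivity (E (fun t => f t ^+ 2 + (K ^+ 2 + (2 * E f ^+ 2 + 2 * E f * K))
   - 2 * E f * f t)).
  by apply: eq_mean => t _; rewrite /g; ring.
transitivity (E (fun t => f t ^+ 2 + (2 * K * f t + K ^+ 2))).
  rewrite meanB !meanD !(mean_cst S0) !meanZ; ring.
by apply: eq_mean => t _; rewrite /g; ring.
Qed.
End PermMoments.

(** * The constant [D] and the decay that it matches *)

Section Dconst.
Context (R : realType).

Lemma sqr_Dconst : Dconst R ^+ 2 * (1 - expR (- 2^-1)) = 1.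
Proof.
have sE : Num.sqrt (expR 1) = expR 2^-1 :> R.
  have -> : expR 1 = expR 2^-1 ^+ 2 :> R.
    by rewrite expr2 -expRD; congr expR; field.
  by rewrite sqrtr_sqr ger0_norm// expR_ge0.
have e1 : 1 < expR (2^-1 : R) by rewrite expR_gt1.
have e0 : 0 < expR (2^-1 : R) by rewrite expR_gt0.
rewrite /Dconst sE sqr_sqrtr; last by rewrite divr_ge0// ?ltW// subr_gt0.
rewrite expRN; field; apply/andP; split; apply: lt0r_neq0; lra.
Qed.

Lemma Dconst_ge1 : 1 <= Dconst R.
Proof.
have k0 : 0 < expR (- 2^-1 : R) by apply: expR_gt0.
have h := sqr_Dconst.
have D0 : 0 <= Dconst R by rewrite /Dconst sqrtr_ge0.
rewrite -(@ler_pXn2r _ 2)// ?nnegrE// expr1n.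
have := sqr_ge0 (Dconst R).
nra.
Qed.

(** The inequality [1 - 1/q <= expR (- 1/q)], raised to the power [q / 2]. *)
Lemma powR_decay_le (q : R) : 1 < q -> ((q - 1) / q) `^ (q / 2) <= expR (- 2^-1).
Proof.
move=> q1; have q0 : 0 < q by lra.
have -> : - 2^-1 = - q^-1 * (q / 2) :> R by field; rewrite gt_eqF.
rewrite expRM; apply: ge0_ler_powR; rewrite ?nnegrE ?expR_ge0//.
- by rewrite divr_ge0// ltW.
- by rewrite divr_ge0//; lra.
- apply: le_trans (expR_ge1Dx _).
  by rewrite le_eqVlt; apply/orP; left; apply/eqP; field; rewrite gt_eqF.
Qed.

End Dconst.

(** * Moments of the positive part by induction on the exponent *)

Section PermMomentBound.
Context {R : realType} {n : nat}.
Implicit Types (f g h U : 'S_n -> R) (q r c : R).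
Local Notation E f := (mean (@predT 'S_n) f).
Local Notation D := (Dconst R).
Let S0 := @card_predT_perm_gt0 n.

(* [D] is chosen so that [1/D^2 = 1 - exp(-1/2)], while
   [(1 - 1/q)^(q/2) <= exp(-1/2)]: if [x = ||g||_q] exceeded [y = D sqrt q C],
   [moment_step] would give [x^q <= y^2 x^(q-2)]. *)
Lemma moment_induction_step g U q c C :
  2 <= q -> 0 < c -> c <= C -> (forall t, 0 < g t) -> (forall t, 0 <= U t) ->
  (forall t, up_var g t <= U t ^+ 2) ->
  E (fun t => U t `^ q) <= c `^ q ->
  E (fun t => g t `^ (q - 1)) <= (D * Num.sqrt (q - 1) * C) `^ (q - 1) ->
  E (fun t => g t `^ q) <= (D * Num.sqrt q * C) `^ q.
Proof.
move=> q2 c0 cC g0 U0 VU Uq IH.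
have q0 : 0 < q by lra.
have q1 : 0 < q - 1 by lra.
have C0 : 0 < C by lra.
have D1 := Dconst_ge1 R; have D0 : 0 < D by lra.
set y := D * Num.sqrt q * C.
have y0 : 0 < y by rewrite !mulr_gt0// sqrtr_gt0.
have Eg0 : 0 < E (fun t => g t `^ q) by apply: mean_gt0 => // t _; exact: powR_gt0.
set x := E (fun t => g t `^ q) `^ q^-1.
have x0 : 0 < x by apply: powR_gt0.
have xq : x `^ q = E (fun t => g t `^ q) by rewrite /x powR_root// ltW.
rewrite -xq; have [xy|yx] := leP x y; first by apply: ler_powR2; lra.
exfalso.
(* Passing from [sqrt q] to [sqrt (q - 1)] in the induction hypothesis gains the factor
   [((q - 1) / q)^(q / 2)]. *)
have h1 : E (fun t => g t `^ (q - 1)) `^ (q / (q - 1)) <= y `^ q * expR (- 2^-1).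
  apply: (@le_trans _ _ ((D * Num.sqrt (q - 1) * C) `^ q)).
    have -> : (D * Num.sqrt (q - 1) * C) `^ q =
        ((D * Num.sqrt (q - 1) * C) `^ (q - 1)) `^ (q / (q - 1)).
      by rewrite -powRrM; congr (_ `^ _); field; rewrite gt_eqF.
    apply: ler_powR2 IH; first by rewrite divr_ge0// ltW.
    by apply: mean_ge0 => t _; exact: powR_ge0.
  have -> : D * Num.sqrt (q - 1) * C = y * ((q - 1) / q) `^ 2^-1.
    rewrite powR12_sqrt ?divr_ge0 ?ltW// sqrtrM ?ltW// sqrtrV ?ltW//.
    by rewrite /y; field; rewrite gt_eqF// sqrtr_gt0.
  rewrite powRM ?powR_ge0 ?(ltW y0)// ler_wpM2l ?powR_ge0// -powRrM (mulrC 2^-1 q).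
  by apply: powR_decay_le; lra.
have h2 : E (fun t => up_var g t * g t `^ (q - 2)) <= C ^+ 2 * x `^ (q - 2).
  apply: (@le_trans _ _ (E (fun t => U t ^+ 2 * g t `^ (q - 2)))).
    by apply: ler_mean => t _; rewrite ler_wpM2r ?powR_ge0.
  apply: (@le_trans _ _ (c ^+ 2 * x `^ (q - 2))).
    by apply: mean_powR_hoelder => //; rewrite xq.
  by rewrite ler_wpM2r ?powR_ge0// ler_pXn2r// ?nnegrE ltW.
have powE z : 0 < z -> z `^ q = z ^+ 2 * z `^ (q - 2).
  move=> z0; rewrite -powR_mulrn ?(ltW z0)// -powRD ?(gt_eqF z0) ?implybT//.
  by congr (_ `^ _); ring.
have := moment_step q2 g0; rewrite -xq => h3.
set k := expR (- 2^-1) in h1.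
have k0 : 0 < k by apply: expR_gt0.
set w := x `^ (q - 2).
have w0 : 0 < w by apply: powR_gt0.
(* As [y < x], also [y^q <= y^2 * x^(q - 2)], and the common factor [w] can be cancelled. *)
have h4 : x ^+ 2 * w <= (y ^+ 2 * k + (q - 1) * C ^+ 2) * w.
  rewrite -powE//; apply: (le_trans h3); rewrite [leRHS]mulrDl; apply: lerD.
    apply: (le_trans h1); rewrite powE// mulrAC ler_wpM2l//.
      by rewrite mulr_ge0 ?sqr_ge0// ltW.
    by apply: ler_powR2; [lra|exact: ltW|exact: ltW].
  by rewrite -mulrA ler_wpM2l// ltW.
move: h4; rewrite ler_pM2r// => h4.
(* Together with [h4] this gives [x^2 <= y^2 - C^2], against [y < x]. *)
have yE : y ^+ 2 * (1 - k) = q * C ^+ 2.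
  rewrite /y !exprMn (sqr_sqrtr (ltW q0)).
  have := sqr_Dconst R; rewrite -/k => Dk.
  by transitivity (D ^+ 2 * (1 - k) * (q * C ^+ 2)); [ring | rewrite Dk mul1r].
have : y ^+ 2 < x ^+ 2 by rewrite ltr_pXn2r// nnegrE ltW.
have := sqr_ge0 C; lra.
Qed.

(** Truncation is nondecreasing and 1-Lipschitz, so it can only shrink the drops. *)
Lemma up_var_max_le f (m e : R) t :
  up_var (fun t => Num.max (f t - m) e) t <= up_var f t.
Proof.
rewrite ler_wpM2l ?invr_ge0//.
apply: ler_sum => i _; apply: ler_sum => j _; set u := (tperm i j * t)%g.
have [h|h] := leP (f t - f u) 0.
  have -> : Num.max (Num.max (f t - m) e - Num.max (f u - m) e) 0 = 0; last by [].
  by apply/max_idPr; rewrite subr_le0 le_max2// lerD2r -subr_le0.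
rewrite ler_pXn2r ?nnegrE ?le_max ?lexx ?orbT ?(ltW h)//.
rewrite ge_max (ltW h) andbT lerBlDr.
have h1 : f u - m <= Num.max (f u - m) e by rewrite le_max lexx.
have h2 : e <= Num.max (f u - m) e by rewrite le_max lexx orbT.
by rewrite ge_max; apply/andP; split; lra.
Qed.

(** The variance bound settles exponents in [[1, 2]]; unit steps by [moment_induction_step] then
    reach [r]. *)
Theorem up_moment_le f U r c : 2 <= r -> 0 < c -> (forall t, 0 <= U t) ->
  (forall t, up_var f t <= U t ^+ 2) ->
  E (fun t => U t `^ r) <= c `^ r ->
  E (fun t => Num.max (f t - E f) 0 `^ r) <= (D * Num.sqrt r * c) `^ r.
Proof.
move=> r2 c0 U0 VU Ur; set m := E f.
have r0 : 0 < r by lra.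
have D1 := Dconst_ge1 R; have D0 : 0 < D by lra.
have sq1 q : 1 <= q -> 1 <= Num.sqrt q.
  by move=> q1; rewrite -sqrtr1 ler_sqrt//; lra.
have Dr : 0 < D * Num.sqrt r by rewrite mulr_gt0// sqrtr_gt0.
have Umono q : 0 < q <= r -> E (fun t => U t `^ q) <= c `^ q.
  by move=> qr; apply: (mean_powR_le_mono S0 qr).
have var_le : E (fun t => (f t - m) ^+ 2) <= c ^+ 2.
  apply: (le_trans (perm_variance_le f)).
  apply: (@le_trans _ _ (E (fun t => U t ^+ 2))); first exact: ler_mean.
  have := Umono 2; rewrite r2 ltr0n powR_mulrn ?(ltW c0)// => /(_ isT).
  by apply: le_trans; apply: ler_mean => t _; rewrite powR_mulrn.
(* The slack [e] is sent to 0 after taking [r]-th roots. *)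
suff main e : 0 < e ->
    E (fun t => Num.max (f t - m) 0 `^ r) <= (D * Num.sqrt r * (c + e)) `^ r.
  have E0 : 0 <= E (fun t => Num.max (f t - m) 0 `^ r).
    by apply: mean_ge0 => t _; exact: powR_ge0.
  rewrite -(powR_root E0 r0); apply: ler_powR2; rewrite ?powR_ge0 ?(ltW r0)//.
  apply/ler_addgt0Pr => e e0.
  have e'0 : 0 < e / (D * Num.sqrt r) by rewrite divr_gt0.
  have := main _ e'0.
  have y0 : 0 <= D * Num.sqrt r * (c + e / (D * Num.sqrt r)).
    by rewrite mulr_ge0 ?addr_ge0 ?ltW.
  move=> /(ler_powR2 (_ : 0 <= r^-1)); rewrite invr_ge0 (ltW r0) => /(_ isT E0).
  rewrite -powRrM divff ?gt_eqF// powRr1// => /le_trans; apply.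
  by rewrite mulrDr lerD2l mulrC divfK// gt_eqF.
(* Truncating from below at [e > 0] keeps every power in the induction positive. *)
move=> e0; pose g t := Num.max (f t - m) e.
have g0 t : 0 < g t by rewrite /g lt_max e0 orbT.
have ce0 : 0 < c + e by lra.
have g2 : E (fun t => g t `^ 2) <= (c + e) `^ 2.
  rewrite powR_mulrn ?(ltW ce0)//.
  apply: (@le_trans _ _ (E (fun t => (f t - m) ^+ 2 + e ^+ 2))).
    apply: ler_mean => t _; rewrite powR_mulrn ?(ltW (g0 t))// /g.
    have := sqr_ge0 (f t - m); have := sqr_ge0 e.
    by move=> h1 h2; have [h|h] := leP (f t - m) e; rewrite ?lerDl ?lerDr.
  rewrite meanD (mean_cst S0).
  have := mulr_gt0 c0 e0; lra.
(* The second moment dominates the lower ones, and [D * sqrt q >= 1] leaves room. *)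
have base q : 1 <= q -> q <= 2 -> E (fun t => g t `^ q) <= (D * Num.sqrt q * (c + e)) `^ q.
  move=> q1 q2; have q02 : 0 < q <= 2 by rewrite q2 andbT; lra.
  apply: (@le_trans _ _ ((c + e) `^ q)).
    by apply: (mean_powR_le_mono S0 q02) => // t _; exact: ltW.
  apply: ler_powR2; [lra|exact: ltW|].
  by apply: ler_peMl; [exact: ltW|apply: mulr_ege1 => //; exact: sq1].
(* All real exponents up to [k + 2] are treated at once, because a step relates [q] to [q - 1]. *)
have all k : forall q, 1 <= q -> q <= r -> q <= k%:R + 2 ->
    E (fun t => g t `^ q) <= (D * Num.sqrt q * (c + e)) `^ q.
  elim: k => [|k IH] q q1 qr qk; first by apply: base => //; lra.
  have [q2|/ltW q2] := leP q 2; first exact: base.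
  have qr' : 0 < q <= r by rewrite qr andbT; lra.
  apply: (moment_induction_step q2 c0 _ g0 U0 _ (Umono _ qr')).
  - by rewrite lerDl ltW.
  - by move=> t; apply: le_trans (VU t); exact: up_var_max_le.
  - apply: IH; [lra|lra|]; move: qk; rewrite -natr1; lra.
have rk : r <= (Num.trunc r).+1%:R + 2.
  have /andP[_ /ltW] := trunc_itv (ltW r0).
  by move=> h; rewrite (le_trans h)// lerDl.
apply: le_trans (all _ r _ (lexx r) rk); last by lra.
apply: ler_mean => t _; apply: ler_powR2; first exact: ltW.
  by rewrite le_max lexx orbT.
by rewrite /g le_max2// ltW.
Qed.

End PermMomentBound.

(** * The suprema of permutation statistics *)

(** Minkowski without roots, from [(x + y)^2 <= (1 + b/a) x^2 + (1 + a/b) y^2]. *)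
Lemma sumr_sqrD_le {R : realType} {I : finType} (x y : I -> R) (c a b : R) :
  0 <= c -> 0 < a -> 0 < b ->
  c * (\sum_i x i ^+ 2) <= a ^+ 2 -> c * (\sum_i y i ^+ 2) <= b ^+ 2 ->
  c * (\sum_i (x i + y i) ^+ 2) <= (a + b) ^+ 2.
Proof.
move=> c0 a0 b0 xa yb.
have ab0 : 0 <= a / b by rewrite divr_ge0// ltW.
have ba0 : 0 <= b / a by rewrite divr_ge0// ltW.
apply: (@le_trans _ _ (c * \sum_i ((1 + b / a) * x i ^+ 2 + (1 + a / b) * y i ^+ 2))).
  rewrite ler_wpM2l// ler_sum// => i _.
  rewrite -subr_ge0.
  rewrite (_ : _ - _ = (b * x i - a * y i) ^+ 2 / (a * b)).
    by rewrite divr_ge0 ?sqr_ge0// mulr_ge0// ltW.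
  by field; rewrite !gt_eqF.
rewrite big_split/= -!mulr_sumr mulrDr !(mulrCA c).
apply: (@le_trans _ _ ((1 + b / a) * a ^+ 2 + (1 + a / b) * b ^+ 2)).
  by apply: lerD; rewrite ler_wpM2l// addr_ge0.
by rewrite le_eqVlt; apply/orP; left; apply/eqP; field; rewrite !gt_eqF.
Qed.

Section DoubleSum.
Context {R : realType} {n : nat}.
Implicit Types (z : 'I_n -> 'I_n -> R) (s : 'S_n).

Lemma double_sumD_le z1 z2 (a b : R) : 0 < a -> 0 < b ->
  n%:R^-1 * (\sum_i \sum_j z1 i j ^+ 2) <= a ^+ 2 ->
  n%:R^-1 * (\sum_i \sum_j z2 i j ^+ 2) <= b ^+ 2 ->
  n%:R^-1 * (\sum_i \sum_j (z1 i j + z2 i j) ^+ 2) <= (a + b) ^+ 2.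
Proof.
move=> a0 b0; rewrite !pair_bigA/=.
by apply: (@sumr_sqrD_le _ _ (fun p => z1 p.1 p.2) (fun p => z2 p.1 p.2)).
Qed.

Lemma mean_double_sum_fst (p : 'I_n -> R) :
  n%:R^-1 * (\sum_(i < n) \sum_(j < n) p i) = \sum_i p i.
Proof.
case: n p => [|m] p; first by rewrite !big_ord0 mulr0.
under eq_bigr do rewrite sumr_const card_ord -[_ *+ _]mulr_natl.
by rewrite -mulr_sumr mulKf// pnatr_eq0.
Qed.

Lemma mean_double_sum_snd (p : 'I_n -> R) :
  n%:R^-1 * (\sum_(i < n) \sum_(j < n) p j) = \sum_i p i.
Proof. by rewrite exchange_big mean_double_sum_fst. Qed.

(** The slack allows for near-maximisers: over all pairs it contributes
    [n * (d / (n + 1))^2 <= d^2]. The denominator [n.+1] is positive also for [n = 0]. *)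
Lemma up_var_le (f : 'S_n -> R) s z (u d : R) : 0 < u -> 0 < d ->
  (forall i j, f s - f (tperm i j * s)%g <= d / n.+1%:R + `|z i j|) ->
  n%:R^-1 * (\sum_i \sum_j z i j ^+ 2) <= u ^+ 2 ->
  up_var f s <= (u + d) ^+ 2.
Proof.
move=> u0 d0 fz zu.
have dn : 0 < d / n.+1%:R by rewrite divr_gt0.
apply: (@le_trans _ _ (n%:R^-1 * (\sum_i \sum_j (`|z i j| + d / n.+1%:R) ^+ 2))).
  rewrite ler_wpM2l ?invr_ge0//; apply: ler_sum => i _; apply: ler_sum => j _.
  have z0 := normr_ge0 (z i j).
  rewrite ler_pXn2r ?nnegrE ?le_max ?lexx ?orbT ?addr_ge0 ?(ltW dn)//.
  by rewrite ge_max [leRHS]addrC fz addrC addr_ge0 ?(ltW dn).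
apply: double_sumD_le => //.
  rewrite (eq_bigr (fun i => \sum_j z i j ^+ 2))// => i _.
  by apply: eq_bigr => j _; rewrite real_normK// num_real.
rewrite mean_double_sum_fst sumr_const card_ord -[_ *+ _]mulr_natl.
rewrite expr_div_n mulrCA ler_piMr ?sqr_ge0//.
rewrite ler_pdivrMr ?exprn_gt0// mul1r -natrX ler_nat.
by rewrite (leq_trans (leqnSn n))// -{1}[n.+1]expn1 leq_pexp2l.
Qed.

Lemma sum_tperm_sub z s i j :
  \sum_k z k (s k) - \sum_k z k ((tperm i j * s)%g k) =
  z i (s i) + z j (s j) - z i (s j) - z j (s i).
Proof.
have [<-|ij] := eqVneq i j.
  by rewrite tperm1 mul1g subrr; ring.
have ji : j != i by rewrite eq_sym.
rewrite (bigD1 i)//= (bigD1 j)//= [in X in _ - X](bigD1 i)//= [in X in _ - X](bigD1 j)//=.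
rewrite !permM tpermL tpermR.
rewrite [in X in _ - X](eq_bigr (fun k => z k (s k))) => [|k /andP[ki kj]]; last first.
  by rewrite permM tpermD// eq_sym.
ring.
Qed.

Lemma mean_perm_apply (g : 'I_n -> R) (k : 'I_n) :
  mean (@predT 'S_n) (fun s => g (s k)) = n%:R^-1 * \sum_j g j.
Proof.
rewrite -mean_perm_onT (mean_perm_on_fibres _ (finset.in_setT k)).
rewrite {1}/mean; congr (_%:R^-1 * _); first by rewrite cardsT card_ord.
rewrite (eq_bigl predT) => [|j]; last by rewrite /= finset.in_setT.
apply: eq_bigr => j _.
rewrite (@eq_mean _ _ _ _ (fun=> g j)); last first.
  by move=> s /andP[_ /eqP ->].
by rewrite mean_cst// card_perm_fibre ?finset.in_setT// fact_gt0.
Qed.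

End DoubleSum.

(** * Drops of the suprema under transpositions *)

Section SupStatistics.
Context {R : realType} {n : nat} (calA : set 'M[R]_n).
Hypothesis calA0 : calA !=set0.
Hypothesis calA_bnd : entrywise_bounded calA.
Implicit Types (a : 'M[R]_n) (s : 'S_n).

Local Notation E f := (mean (@predT 'S_n) f).
Local Notation Z := (sup_sum calA).
Local Notation W := (sup_root_sum_sq calA).
Local Notation M := (max_sup_abs calA).

Let bnd (i j : 'I_n) : R := sup [set `|a i j| | a in calA].

Let le_bnd a i j : calA a -> `|a i j| <= bnd i j.
Proof. by move=> Aa; apply: ub_le_sup; [exact: calA_bnd|exists a]. Qed.

Let has_sup_sum s : has_sup [set \sum_(k < n) a k (s k) | a in calA].
Proof.
split; first by case: calA0 => a Aa; exists (\sum_(k < n) a k (s k)), a.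
exists (\sum_(k < n) bnd k (s k)) => _ [a Aa <-].
by apply: ler_sum => k _; apply: (le_trans (ler_norm _)); exact: le_bnd.
Qed.

Let has_sup_root s :
  has_sup [set Num.sqrt (\sum_(k < n) a k (s k) ^+ 2) | a in calA].
Proof.
split; first by case: calA0 => a Aa; exists (Num.sqrt (\sum_(k < n) a k (s k) ^+ 2)), a.
exists (Num.sqrt (\sum_(k < n) bnd k (s k) ^+ 2)) => _ [a Aa <-].
rewrite ler_wsqrtr// ler_sum// => k _.
by rewrite -real_normK ?num_real// lerXn2r ?nnegrE// ?le_bnd// (le_trans _ (le_bnd _ _ Aa)).
Qed.

Lemma sup_sum_ge a s : calA a -> \sum_(k < n) a k (s k) <= Z s.
Proof. by move=> Aa; apply: ub_le_sup; [exact: (has_sup_sum s).2|exists a]. Qed.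

Lemma sup_root_ge a s : calA a -> Num.sqrt (\sum_(k < n) a k (s k) ^+ 2) <= W s.
Proof. by move=> Aa; apply: ub_le_sup; [exact: (has_sup_root s).2|exists a]. Qed.

Lemma sup_root_ge0 s : 0 <= W s.
Proof. by have [a Aa] := calA0; apply: le_trans (sup_root_ge s Aa); exact: sqrtr_ge0. Qed.

Lemma max_sup_abs_ge a s k : calA a -> `|a k (s k)| <= M s.
Proof.
move=> Aa; apply: (le_trans (le_bnd _ _ Aa)).
exact: (le_bigmax _ (fun k => bnd k (s k))).
Qed.

Lemma max_sup_abs_ge0 s : 0 <= M s.
Proof. by rewrite /max_sup_abs; elim/big_ind: _ => // [x y x0 y0|i _]; [rewrite le_max x0
 | have [a Aa] := calA0; apply: le_trans (le_bnd _ _ Aa)]. Qed.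

Lemma sup_sum_adherent s (d : R) : 0 < d ->
  exists2 a, calA a & Z s <= \sum_(k < n) a k (s k) + d.
Proof.
move=> d0; have [_ [a Aa <-] h] := sup_adherent d0 (has_sup_sum s).
by exists a => //; rewrite -lerBlDr ltW.
Qed.

Lemma sup_root_adherent s (d : R) : 0 < d ->
  exists2 a, calA a & W s <= Num.sqrt (\sum_(k < n) a k (s k) ^+ 2) + d.
Proof.
move=> d0; have [_ [a Aa <-] h] := sup_adherent d0 (has_sup_root s).
by exists a => //; rewrite -lerBlDr ltW.
Qed.

Let rt a s : R := Num.sqrt (\sum_(k < n) a k (s k) ^+ 2).

Let rt_sqr a s : rt a s ^+ 2 = \sum_(k < n) a k (s k) ^+ 2.
Proof. by rewrite sqr_sqrtr// sumr_ge0// => k _; exact: sqr_ge0. Qed.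

Let rt_ge0 a s : 0 <= rt a s. Proof. exact: sqrtr_ge0. Qed.

(** For roots [y' <= y] one has [y * (y - y') <= y^2 - y'^2], and the swap removes only the squares
    at [i] and [j]. *)
Let rt_diff a s i j : rt a s - rt a (tperm i j * s)%g <=
  (a i (s i) ^+ 2 + a j (s j) ^+ 2) / rt a s.
Proof.
have := rt_ge0 a s; rewrite le_eqVlt => /orP[/eqP <-|y0].
  (* For a zero root the quotient is 0 by convention, and the difference is nonpositive. *)
  by rewrite invr0 mulr0 sub0r oppr_le0 rt_ge0.
have y'0 := rt_ge0 a (tperm i j * s)%g.
rewrite ler_pdivlMr// mulrBl -expr2.
have := sum_tperm_sub (fun k l => a k l ^+ 2) s i j.
rewrite /= -!rt_sqr => e.
have := sqr_ge0 (a i (s j)); have := sqr_ge0 (a j (s i)).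
set y := rt a s in y0 e *; set y' := rt a (tperm i j * s)%g in y'0 e *.
have [yy|yy] := leP y y'.
  have := ler_wpM2r (ltW y0) yy; have := sqr_ge0 (a i (s i)); have := sqr_ge0 (a j (s j)); lra.
have := ler_wpM2l y'0 (ltW yy); lra.
Qed.

(** After splitting the square of the sum, each half reduces to the sum of [a_k^4 / y^2], which is
    at most [m^2] since [y^2] is the sum of the [a_k^2]. *)
Let rt_diff_sqr a s (m : R) : (forall k, `|a k (s k)| <= m) ->
  n%:R^-1 * (\sum_i \sum_j ((a i (s i) ^+ 2 + a j (s j) ^+ 2) / rt a s) ^+ 2) <=
  (2 * m) ^+ 2.
Proof.
move=> am; set y := rt a s.
pose p k := a k (s k) ^+ 4 / y ^+ 2.
apply: (@le_trans _ _ (n%:R^-1 * (\sum_(i < n) \sum_(j < n) (2 * p i + 2 * p j)))).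
  rewrite ler_wpM2l ?invr_ge0//; apply: ler_sum => i _; apply: ler_sum => j _.
  have -> : 2 * p i + 2 * p j = 2 * (a i (s i) ^+ 4 + a j (s j) ^+ 4) / y ^+ 2.
    by rewrite /p; ring.
  rewrite expr_div_n ler_wpM2r ?invr_ge0 ?sqr_ge0//.
  have := sqr_ge0 (a i (s i) ^+ 2 - a j (s j) ^+ 2); lra.
have -> : n%:R^-1 * (\sum_(i < n) \sum_(j < n) (2 * p i + 2 * p j)) = 4 * \sum_k p k.
  under eq_bigr do rewrite big_split/=.
  rewrite big_split/= mulrDr mean_double_sum_fst mean_double_sum_snd -!mulr_sumr; ring.
rewrite exprMn (_ : 2 ^+ 2 = 4 :> R); last by ring.
rewrite ler_wpM2l//.
apply: (@le_trans _ _ (m ^+ 2 / y ^+ 2 * \sum_(k < n) a k (s k) ^+ 2)).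
  rewrite mulr_sumr; apply: ler_sum => k _.
  have -> : p k = a k (s k) ^+ 2 / y ^+ 2 * a k (s k) ^+ 2 by rewrite /p; ring.
  rewrite ler_wpM2r ?sqr_ge0// ler_wpM2r ?invr_ge0 ?sqr_ge0//.
  by rewrite -real_normK ?num_real// lerXn2r ?nnegrE// (le_trans _ (am k)).
rewrite -rt_sqr -/y -mulrA; have [->|y0] := eqVneq y 0.
  by rewrite expr0n/= mulr0 mulr0 sqr_ge0.
by rewrite mulVf ?mulr1// expf_neq0.
Qed.

Lemma up_var_root_le a s (e : R) : calA a -> 0 < e -> up_var (rt a) s <= (2 * (M s + e)) ^+ 2.
Proof.
move=> Aa e0; have M0 := max_sup_abs_ge0 s.
rewrite (_ : 2 * (M s + e) = (2 * M s + e) + e); last by ring.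
apply: (@up_var_le _ _ _ _ (fun i j => (a i (s i) ^+ 2 + a j (s j) ^+ 2) / rt a s)) => //.
- by lra.
- move=> i j; apply: (le_trans (rt_diff a s i j)); apply: (le_trans (ler_norm _)).
  by rewrite lerDr divr_ge0// ltW.
- apply: (le_trans (rt_diff_sqr (fun k => max_sup_abs_ge s k Aa))).
  by rewrite ler_pXn2r// ?nnegrE; lra.
Qed.

(** A matrix nearly optimal at [s] bounds [W] from below at the swapped permutation, so the drop of
    [W] is that of [rt a] up to slack. *)
Lemma up_var_sup_root_le s (e : R) : 0 < e -> up_var W s <= (2 * (M s + e)) ^+ 2.
Proof.
move=> e0; have M0 := max_sup_abs_ge0 s.
have en : 0 < e / n.+1%:R by rewrite divr_gt0.
have [a Aa Wa] := sup_root_adherent s en.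
rewrite (_ : 2 * (M s + e) = (2 * M s + e) + e); last by ring.
apply: (@up_var_le _ _ _ _ (fun i j => (a i (s i) ^+ 2 + a j (s j) ^+ 2) / rt a s)) => //.
- by lra.
- move=> i j; have h := sup_root_ge (tperm i j * s)%g Aa.
  have := rt_diff a s i j; have := ler_norm ((a i (s i) ^+ 2 + a j (s j) ^+ 2) / rt a s).
  move: Wa h; rewrite -!/(rt _ _).
  set x1 := W s; set x2 := W _; set x3 := rt a s; set x4 := rt a _; set x5 := e / _.
  set x6 := _ / x3; set x7 := `|_|; lra.
- apply: (le_trans (rt_diff_sqr (fun k => max_sup_abs_ge s k Aa))).
  by rewrite ler_pXn2r// ?nnegrE; lra.
Qed.

Lemma up_var_sup_sum_le s (K e : R) : 0 < e -> 0 <= K ->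
  (forall a, calA a -> n%:R^-1 * (\sum_i \sum_j a i j ^+ 2) <= K ^+ 2) ->
  up_var Z s <= (2 * W s + 2 * K + 5 * e) ^+ 2.
Proof.
move=> e0 K0 aK; have W0 := sup_root_ge0 s.
have en : 0 < e / n.+1%:R by rewrite divr_gt0.
have [a Aa Za] := sup_sum_adherent s en.
have aW := sup_root_ge s Aa.
have We0 : 0 < W s + e by lra.
have Ke0 : 0 < K + e by lra.
(* The two removed entries cost [W s + e] each, the two inserted ones [K + e] each; the last [e]
   pays for the near-maximiser. *)
rewrite (_ : _ + 5 * e = ((W s + e) + (W s + e)) + ((K + e) + (K + e)) + e); last by ring.
apply: (@up_var_le _ _ _ _ (fun i j => (a i (s i) + a j (s j)) + (- a i (s j) + - a j (s i)))) => //.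
- by lra.
- move=> i j; have h := sup_sum_ge (tperm i j * s)%g Aa.
  have := sum_tperm_sub (fun k l => a k l) s i j.
  have := ler_norm ((a i (s i) + a j (s j)) + (- a i (s j) + - a j (s i))).
  move: Za h => /=.
  set x1 := Z s; set x2 := Z _; set x3 := \sum_(k < n) _; set x4 := \sum_(k < n) _; set x5 := e / _.
  set x6 := `|_|; lra.
have sW : \sum_(k < n) a k (s k) ^+ 2 <= (W s + e) ^+ 2.
  rewrite -rt_sqr ler_pXn2r ?nnegrE ?(ltW We0)//.
  by apply: (le_trans aW); rewrite lerDl ltW.
have sK : n%:R^-1 * (\sum_i \sum_j (- a i (s j)) ^+ 2) <= (K + e) ^+ 2.
  rewrite (eq_bigr (fun i => \sum_j a i j ^+ 2)) => [|i _]; last first.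
    rewrite [RHS](reindex_inj (@perm_inj _ s))/=.
    by apply: eq_bigr => j _; rewrite sqrrN.
  by apply: (le_trans (aK _ Aa)); rewrite ler_pXn2r ?nnegrE//; lra.
apply: double_sumD_le; [lra|lra| |].
  by apply: double_sumD_le => //; rewrite ?mean_double_sum_fst ?mean_double_sum_snd.
by apply: double_sumD_le => //; rewrite exchange_big.
Qed.

End SupStatistics.

(** * From the root sums of squares to the linear sums *)

Section MomentCombination.
Context {R : realType} {n : nat}.
Implicit Types (U Z W M : 'S_n -> R).

Local Notation E f := (mean (@predT 'S_n) f).
Local Notation D := (Dconst R).
Let S0 := @card_predT_perm_gt0 n.

(** The left side is the second moment of [rt], that is, its squared mean plus its variance. *)
Lemma double_sum_le (a : 'M[R]_n) U (A B : R) : 0 <= B ->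
  let rt s : R := Num.sqrt (\sum_(k < n) a k (s k) ^+ 2) in
  E rt <= A -> (forall s, up_var rt s <= U s ^+ 2) -> E (fun s => U s ^+ 2) <= B ^+ 2 ->
  n%:R^-1 * (\sum_i \sum_j a i j ^+ 2) <= (A + B) ^+ 2.
Proof.
move=> B0 rt rtA VU UB.
have -> : n%:R^-1 * (\sum_i \sum_j a i j ^+ 2) = E (fun s => rt s ^+ 2).
  rewrite (eq_mean (g := fun s : 'S_n => \sum_(k < n) a k (s k) ^+ 2)) => [|s _]; last first.
    by rewrite sqr_sqrtr// sumr_ge0// => k _; exact: sqr_ge0.
  rewrite mean_sum mulr_sumr; apply: eq_bigr => k _.
  by rewrite (mean_perm_apply (fun j => a k j ^+ 2)).
have rt0 : 0 <= E rt by apply: mean_ge0 => s _; exact: sqrtr_ge0.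
have := perm_variance_le rt; rewrite mean_sqrB//.
have : E (up_var rt) <= B ^+ 2 by apply: le_trans UB; apply: ler_mean.
have : E rt ^+ 2 <= A ^+ 2 by rewrite ler_pXn2r ?nnegrE// (le_trans rt0).
have := mulr_ge0 (le_trans rt0 rtA) B0; lra.
Qed.

(* The slack [b / 10] absorbs suprema that are not attained. *)
Lemma moment_combination Z W M (r b : R) : 2 <= r -> 0 < b ->
  (forall s, 0 <= M s) -> (forall s, 0 <= W s) ->
  (forall s, up_var W s <= (2 * (M s + b / 10)) ^+ 2) ->
  (E (fun s => (2 * (M s + b / 10)) ^+ 2) <= (2 * (b + b / 10)) ^+ 2 ->
    forall s, up_var Z s <=
      (2 * W s + 2 * (E W + 2 * (b + b / 10)) + 5 * (b / 10)) ^+ 2) ->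
  E (fun s => M s `^ r) <= b `^ r ->
  E (fun s => Num.max (Z s - E Z) 0 `^ r) <=
    (4 * D * Num.sqrt r * E W + 10 * D ^+ 2 * r * b) `^ r.
Proof.
move=> r2 b0 M0 W0 VW VZ Mb; set e := b / 10 in VW VZ *; set A := E W in VZ *.
have e0 : 0 < e by rewrite /e; lra.
have r0 : 0 < r by lra.
have r1 : 1 <= r by lra.
have be0 : 0 < b + e by lra.
have A0 : 0 <= A by apply: mean_ge0.
have D1 := Dconst_ge1 R.
set y := D * Num.sqrt r.
have y1 : 1 <= y.
  rewrite /y mulr_ege1//; have <- : Num.sqrt 1 = 1 :> R by exact: sqrtr1.
  by rewrite ler_sqrt//; lra.
have y2 : D ^+ 2 * r = y ^+ 2 by rewrite /y exprMn (sqr_sqrtr (ltW r0)).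
have Me0 s : 0 <= M s + e by have := M0 s; lra.
have Ur : E (fun s => (2 * (M s + e)) `^ r) <= (2 * (b + e)) `^ r.
  by apply: mean_powR_scale => //; [lra|exact: mean_powR_addc].
have U2 : E (fun s => (2 * (M s + e)) ^+ 2) <= (2 * (b + e)) ^+ 2.
  have q02 : 0 < (2:R) <= r by rewrite r2 andbT.
  have U0 s : 0 <= 2 * (M s + e) by rewrite mulr_ge0.
  have c0 : 0 < 2 * (b + e) by lra.
  have := mean_powR_le_mono S0 q02 c0 (fun s _ => U0 s) Ur.
  rewrite (powR_mulrn 2 (ltW c0)); apply: le_trans.
  by apply: ler_mean => s _; rewrite (powR_mulrn 2 (U0 s)).
have Wr : E (fun s => Num.max (W s - A) 0 `^ r) <= (y * (2 * (b + e))) `^ r.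
  by apply: (up_moment_le r2 _ _ VW Ur) => [|s]; [lra|rewrite mulr_ge0].
set K := A + 2 * (b + e) in VZ.
have K0 : 0 <= K by rewrite /K; lra.
set c := 2 * (y * (2 * (b + e))) + (2 * A + 2 * K + 5 * e).
have yb0 : 0 < y * (2 * (b + e)) by apply: mulr_gt0; lra.
(* The moment bound for the positive part of [W - A] thus controls the norm of [W] itself. *)
have Wmax s : W s <= Num.max (W s - A) 0 + A by rewrite -lerBlDr le_max lexx.
have max0 (x : R) : 0 <= Num.max x 0 by rewrite le_max lexx orbT.
have V0 s : 0 <= 2 * W s + 2 * K + 5 * e by have := W0 s; lra.
have Vr : E (fun s => (2 * W s + 2 * K + 5 * e) `^ r) <= c `^ r.
  apply: (@le_trans _ _ (E (fun s => (2 * Num.max (W s - A) 0 + (2 * A + 2 * K + 5 * e)) `^ r))).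
    apply: ler_mean => s _; apply: ler_powR2; [exact: ltW|exact: V0|].
    by have := Wmax s; set x := Num.max _ _; lra.
  apply: mean_powR_addc => //; [lra|lra|by move=> s _; rewrite mulr_ge0|].
  by apply: mean_powR_scale => //; lra.
have c0 : 0 < c by rewrite /c; lra.
apply: (le_trans (up_moment_le r2 c0 V0 (VZ U2) Vr)).
rewrite -/y; apply: ler_powR2; first exact: ltW.
  by rewrite mulr_ge0 ?(ltW c0)//; lra.
have -> : 4 * D * Num.sqrt r * A + 10 * D ^+ 2 * r * b = 4 * y * A + 10 * y ^+ 2 * b.
  by rewrite -y2 /y; ring.
(* Here [y * c = 4 y A + 4.4 y^2 b + 4.9 y b], and [y <= y^2] gives at most [9.3 y^2 b] for the
   terms in [b]. *)
rewrite /c /K /e.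
have y10 : 0 <= y - 1 by lra.
have y0 : 0 <= y by lra.
have := mulr_ge0 (mulr_ge0 y0 y10) (ltW b0).
have := mulr_ge0 (mulr_ge0 y0 y0) (ltW b0); lra.
Qed.

End MomentCombination.

(** [b] is any positive bound on the norm of the maximum. That norm may vanish, so it is reached
    only in the limit, in [sup_sum_norm_le]. *)
Theorem sup_sum_moment {R : realType} {n : nat} (calA : set 'M[R]_n) (r b : R) :
  calA !=set0 -> entrywise_bounded calA -> 2 <= r -> 0 < b ->
  mean (@predT 'S_n) (fun s => max_sup_abs calA s `^ r) <= b `^ r ->
  mean (@predT 'S_n) (fun s =>
    Num.max (sup_sum calA s - mean (@predT 'S_n) (sup_sum calA)) 0 `^ r) <=
  (4 * Dconst R * Num.sqrt r * mean (@predT 'S_n) (sup_root_sum_sq calA)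
   + 10 * Dconst R ^+ 2 * r * b) `^ r.
Proof.
move=> calA0 calA_bnd r2 b0.
have e0 : 0 < b / 10 by lra.
have be0 : 0 <= 2 * (b + b / 10) by lra.
apply: moment_combination => //.
- exact: max_sup_abs_ge0.
- exact: sup_root_ge0.
- by move=> s; apply: up_var_sup_root_le.
- move=> U2 s; apply: up_var_sup_sum_le => //.
    by rewrite addr_ge0// mean_ge0// => t _; exact: sup_root_ge0.
  move=> a Aa; apply: double_sum_le U2 => //.
    by apply: ler_mean => t _; exact: sup_root_ge.
  by move=> t; exact: up_var_root_le.
Qed.

(** * Transfer to the probability space *)

Section UniformPermutation.
Context {R : realType} {d : measure_display} {T : measurableType d}
  (P : probability T R) {n : nat} (sigma : T -> 'S_n).
Hypothesis sigma_unif : uniform_permutation P sigma.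

(** Measurability of the preimages of points suffices: the composite is a finite combination of
    their indicators. *)
Lemma integral_comp_uniform_permutation (g : 'S_n -> R) :
  (\int[P]_w (g (sigma w))%:E = (mean (@predT 'S_n) g)%:E)%E.
Proof.
have mS s : measurable (sigma @^-1` [set s]) by have [] := sigma_unif s.
rewrite (eq_integral (fun w => \sum_(s : 'S_n) ((g s)%:E * (\1_(sigma @^-1` [set s]) w)%:E)%E)%E); last first.
  move=> w _; rewrite (bigD1 (sigma w))//= big1 ?adde0.
    by rewrite indicE mem_set//= mule1.
  move=> s sw; rewrite indicE memNset ?mule0//=.
  by move=> /= ws; rewrite ws eqxx in sw.
rewrite integral_sum//; last first.
  by move=> s; apply: integrableZl => //; exact: integrable_indic.
rewrite /mean mulr_sumr -sumEFin; apply: eq_bigr => s _.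
rewrite integralZl//; last exact: integrable_indic.
rewrite integral_indic// setIT.
transitivity ((g s)%:E * (n`!%:R^-1)%:E)%E.
  by congr (_ * _)%E; have [_] := sigma_unif s.
rewrite -EFinM mulrC; congr (_%:E); congr (_%:R^-1 * _).
by rewrite -card_Sn; apply: eq_card.
Qed.

Lemma expectation_comp_uniform_permutation (g : 'S_n -> R) :
  ('E_P[g \o sigma] = (mean (@predT 'S_n) g)%:E)%E.
Proof. by rewrite unlock -integral_comp_uniform_permutation. Qed.

Lemma Lnorm_comp_uniform_permutation (g : 'S_n -> R) (r : R) :
  ('N[P]_(r%:E)[EFin \o (g \o sigma)] =
   (mean (@predT 'S_n) (fun s => `|g s| `^ r) `^ r^-1)%:E)%E.
Proof.
rewrite unlock -poweR_EFin -integral_comp_uniform_permutation; congr (_ `^ _)%E.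
Qed.

Lemma probability_comp_uniform_permutation (Q : pred 'S_n) :
  (P [set w | Q (sigma w)] = (mean (@predT 'S_n) (fun s => (Q s)%:R))%:E)%E.
Proof.
have mQ : measurable [set w | Q (sigma w)].
  rewrite (_ : [set w | _] = \bigcup_(s in [set s | Q s]) (sigma @^-1` [set s])).
    apply: fin_bigcup_measurable; first exact: finite_finset.
    by move=> s _; have [] := sigma_unif s.
  by apply/seteqP; split=> [w Qw|w [s Qs ws]]; [by exists (sigma w)|by rewrite /= ws].
rewrite -integral_comp_uniform_permutation -[in LHS](setIT [set w | _]) -integral_indic//.
by apply: eq_integral => w _; rewrite indicE; congr (_%:R%:E); rewrite mem_setE.
Qed.

End UniformPermutation.

(** * The norm bound and the tail bound on the symmetric group *)

Section FinalBounds.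
Context {R : realType} {n : nat} (calA : set 'M[R]_n).
Hypothesis calA0 : calA !=set0.
Hypothesis calA_bnd : entrywise_bounded calA.

Local Notation E f := (mean (@predT 'S_n) f).

Lemma sup_sum_norm_le (r : R) : 2 <= r ->
  E (fun s => Num.max (sup_sum calA s - E (sup_sum calA)) 0 `^ r) `^ r^-1 <=
  4 * Dconst R * Num.sqrt r * E (sup_root_sum_sq calA)
  + 10 * Dconst R ^+ 2 * r * E (fun s => max_sup_abs calA s `^ r) `^ r^-1.
Proof.
move=> r2; have r0 : 0 < r by lra.
have D1 := Dconst_ge1 R.
have k0 : 0 < 10 * Dconst R ^+ 2 * r.
  by rewrite !mulr_gt0// ?exprn_gt0//; lra.
have B0 : 0 <= E (fun s => max_sup_abs calA s `^ r) `^ r^-1 by exact: powR_ge0.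
apply/ler_addgt0Pr => e e0.
(* Scaled so that enlarging the norm by [e1] enlarges the bound by exactly [e]. *)
pose e1 := e / (10 * Dconst R ^+ 2 * r).
have e10 : 0 < e1 by exact: divr_gt0.
have b0 := ltr_wpDl B0 e10.
have Bb : E (fun s => max_sup_abs calA s `^ r) <=
    (E (fun s => max_sup_abs calA s `^ r) `^ r^-1 + e1) `^ r.
  rewrite -[X in X <= _](@powR_root _ _ r) ?mean_ge0//; last first.
    by move=> s _; exact: powR_ge0.
  by apply: ler_powR2; rewrite ?(ltW r0)// lerDl ltW.
have := sup_sum_moment calA0 calA_bnd r2 b0 Bb.
move=> /(ler_powR2 (_ : 0 <= r^-1)); rewrite invr_ge0 (ltW r0) => /(_ isT).
rewrite mean_ge0 => [/(_ isT)|s _]; last exact: powR_ge0.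
rewrite -[X in _ <= X -> _]powRrM divff ?gt_eqF//.
rewrite [X in _ <= X -> _]powRr1; last first.
  have D0 : 0 <= Dconst R by lra.
  have A0 : 0 <= E (sup_root_sum_sq calA).
    by apply: mean_ge0 => s _; exact: sup_root_ge0.
  have c0 : 0 <= 4 * Dconst R * Num.sqrt r by rewrite !mulr_ge0 ?(sqrtr_ge0 r).
  by apply: addr_ge0; apply: mulr_ge0 => //; exact: ltW.
move=> /le_trans; apply; rewrite mulrDr addrA lerD2l /e1 mulrC divfK// gt_eqF//.
Qed.

(** Markov's inequality divides by this bound. A nonzero entry at [(i, j)] makes the root sum
    positive at [tperm i j], which sends [i] to [j]. *)
Lemma sup_sum_bound_gt0 (r : R) : 2 < r -> (exists2 a, calA a & a != 0) ->
  0 < 4 * Dconst R * Num.sqrt r * E (sup_root_sum_sq calA)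
  + 10 * Dconst R ^+ 2 * r * E (fun s => max_sup_abs calA s `^ r) `^ r^-1.
Proof.
move=> r2 [a Aa a0]; have r0 : 0 < r by lra.
have D1 := Dconst_ge1 R; have D0 : 0 < Dconst R by lra.
apply: ltr_pwDl; last by rewrite !mulr_ge0 ?sqr_ge0 ?powR_ge0 ?(ltW r0) ?(ltW D0).
have c0 : 0 < 4 * Dconst R * Num.sqrt r by rewrite !mulr_gt0 ?(sqrtr_gt0 r).
apply: mulr_gt0 => //.
have [i [j aij]] : exists i j, a i j != 0.
  apply: contrapT => h; move: a0; apply/negP; rewrite negbK; apply/eqP/matrixP => i j.
  rewrite mxE; apply/eqP; apply: contrapT => aij; apply: h; exists i, j; exact/negP.
rewrite /mean mulr_gt0 ?invr_gt0 ?ltr0n ?card_predT_perm_gt0//.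
rewrite (bigD1 (tperm i j))//= ltr_pwDl//; last first.
  by rewrite sumr_ge0// => s _; exact: sup_root_ge0.
apply: lt_le_trans (sup_root_ge calA0 calA_bnd _ Aa).
rewrite sqrtr_gt0 (bigD1 i)//= tpermL; apply: ltr_pwDl.
  by rewrite lt0r sqrf_eq0 aij sqr_ge0.
by rewrite sumr_ge0// => k _; exact: sqr_ge0.
Qed.

(** Markov for the [r]-th moment at level [expR 1 * m], where [m] bounds the norm: the ratio is
    [expR (- r)]. *)
Lemma sup_sum_tail_le (r : R) : 2 < r -> (exists2 a, calA a & a != 0) ->
  E (fun s => (E (sup_sum calA)
     + 4 * expR 1 * Dconst R * Num.sqrt r * E (sup_root_sum_sq calA)
     + 10 * expR 1 * Dconst R ^+ 2 * r * E (fun s => max_sup_abs calA s `^ r) `^ r^-1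
    <= sup_sum calA s)%R%:R) <= expR (- r).
Proof.
move=> r2 ha; have r0 : 0 < r by lra.
have := sup_sum_bound_gt0 r2 ha.
have := sup_sum_norm_le (ltW r2).
set B := E (fun s => max_sup_abs calA s `^ r) `^ r^-1.
set A := E (sup_root_sum_sq calA).
set m := 4 * _ * _ * _ + _ => Xm m0.
have Xr : E (fun s => Num.max (sup_sum calA s - E (sup_sum calA)) 0 `^ r) <= m `^ r.
  rewrite -[X in X <= _](@powR_root _ _ r) ?mean_ge0//; last first.
    by move=> s _; exact: powR_ge0.
  by apply: ler_powR2 Xm; rewrite ?(ltW r0)//; exact: powR_ge0.
have em0 : 0 < (expR 1 * m) `^ r by rewrite powR_gt0// mulr_gt0// expR_gt0.
apply: (@le_trans _ _ (E (fun s => ((expR 1 * m) `^ r)^-1 *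
    Num.max (sup_sum calA s - E (sup_sum calA)) 0 `^ r))).
  apply: ler_mean => s _; case: (boolP (_ <= sup_sum calA s)) => [h|_]; last first.
    by rewrite mulr0n mulr_ge0 ?powR_ge0// invr_ge0 ltW.
  rewrite mulr1n ler_pdivlMl// mulr1; apply: ler_powR2; first exact: ltW.
    by rewrite mulr_ge0 ?expR_ge0// ltW.
  rewrite le_max lerBrDl (le_trans _ h)//.
  by rewrite le_eqVlt; apply/orP; left; apply/eqP; rewrite /m; ring.
rewrite meanZ ler_pdivrMl//; apply: (le_trans Xr).
rewrite powRM ?expR_ge0 ?(ltW m0)// -expRM mul1r mulrAC -expRD subrr expR0 mul1r.
by [].
Qed.

End FinalBounds.

Unset Implicit Arguments.

(** If all matrices in [calA] vanish, the tail event reads [0 <= 0] and has probability 1, above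
    [expR (2 - r)] once [r > 2]; the disjunction in the tail bound excludes this case. *)
Theorem proposition4p9 (R : realType) (d : measure_display)
    (T : measurableType d) (P : probability T R) (n : nat)
    (sigma : T -> 'S_n) (calA : set 'M[R]_n)
    (sigma_unif : uniform_permutation P sigma)
    (calA_neq0 : calA !=set0)
    (calA_bnd : entrywise_bounded calA) :
  let Z := sup_sum calA \o sigma in
  let D := Dconst R in
  let A := ('E_P[sup_root_sum_sq calA \o sigma])%E in
  let B := fun r : R =>
    ('N[P]_(r%:E)[EFin \o (max_sup_abs calA \o sigma)])%E in
  (forall r : R, 2 <= r ->
    ('N[P]_(r%:E)[(fun w : T => maxe ((Z w)%:E - 'E_P[Z]) 0)]
     <= (4 * D * Num.sqrt r)%:E * A + (10 * D ^+ 2 * r)%:E * B r)%E) /\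
  (forall r : R, 0 <= r -> (r <= 2 \/ exists2 a, calA a & a != 0) ->
    (P [set w | 'E_P[Z] + (4 * expR 1 * D * Num.sqrt r)%:E * A
                + (10 * expR 1 * D ^+ 2 * r)%:E * B r <= (Z w)%:E]
     <= (expR (2 - r))%:E)%E).
Proof.
move=> Z D A B.
have EZ : ('E_P[Z])%E = (mean (@predT 'S_n) (sup_sum calA))%:E.
  exact: expectation_comp_uniform_permutation.
have EA : A = (mean (@predT 'S_n) (sup_root_sum_sq calA))%:E.
  exact: expectation_comp_uniform_permutation.
(* [B r] is finite for every real [r], so at [r = 0] its product with [r] is 0. *)
have BE r : B r = (mean (@predT 'S_n) (fun s => max_sup_abs calA s `^ r) `^ r^-1)%:E.
  rewrite /B (Lnorm_comp_uniform_permutation sigma_unif).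
  congr (_ `^ _)%:E; apply: eq_mean => s _; rewrite ger0_norm//.
  exact: max_sup_abs_ge0.
split=> [r r2|r r0 hr].
  rewrite EZ EA BE -!EFinM -EFinD.
  rewrite (_ : (fun w : T => _) = EFin \o ((fun s =>
    Num.max (sup_sum calA s - mean (@predT 'S_n) (sup_sum calA)) 0) \o sigma)); last first.
    by apply/funext => w /=; rewrite EFin_max.
  rewrite (Lnorm_comp_uniform_permutation sigma_unif) lee_fin.
  rewrite (@eq_mean _ _ _ _ (fun s => Num.max (sup_sum calA s
    - mean (@predT 'S_n) (sup_sum calA)) 0 `^ r)) => [|s _]; last first.
    by rewrite ger0_norm// le_max lexx orbT.
  exact: sup_sum_norm_le.
rewrite EZ EA BE -!EFinM -!EFinD.
under eq_set do rewrite lee_fin.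
rewrite (probability_comp_uniform_permutation sigma_unif (fun s => _ <= sup_sum calA s)).
(* For [r <= 2] the right side is at least 1. *)
rewrite lee_fin; have [r2|r2] := leP r 2.
  apply: (@le_trans _ _ (mean (@predT 'S_n) (fun=> 1))).
    by apply: ler_mean => s _; rewrite lern1 leq_b1.
  by rewrite mean_cst ?card_predT_perm_gt0// -[leLHS]expR0 ler_expR subr_ge0.
case: hr => [|ha]; first by rewrite leNgt r2.
apply: (le_trans (sup_sum_tail_le calA_neq0 calA_bnd r2 ha)).
by rewrite ler_expR lerDr.
Qed.
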